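(* Let $G$ be a finite group whose derived subgroup $G'$ has square-free order. Then every Cayley graph $\mathrm{Cay}(G,X)$ on $G$ of valency at least four admits a nowhere-zero $3$-flow.
   Context: Graphs are finite, undirected and loopless, with parallel edges allowed. A $k$-flow in a graph $\Gamma$ is a pair $(D,\varphi)$ where $D$ is an orientation of $\Gamma$ and $\varphi$ assigns an integer to each arc with $|\varphi(e)|<k$, such that at every vertex the sum of $\varphi$ over outgoing arcs equals the sum over incoming arcs; it is nowhere-zero if $\varphi(e)\neq 0$ for all arcs. For a finite group $G$, a connection multiset is a multiset $X$ of elements of $G\setminus\{1\}$ with $X=X^{-1}$ such that each $x\in X$ and $x^{-1}$ have equal multiplicities; $\mathrm{Cay}(G,X)$ has vertex set $G$, and the number of edges joining $g$ and $h$ equals the multiplicity of $g^{-1}h$ in $X$. Its valency is $|X|$ counted with multiplicity. $G'$ is the subgroup generated by all commutators $x^{-1}y^{-1}xy$. *)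

(* Defs.v *)
From HB Require Import structures.
From mathcomp Require Import all_boot all_order all_algebra all_fingroup all_solvable.
From mathcomp Require Export finmap multiset.

Set Implicit Arguments.
Unset Strict Implicit.
Unset Printing Implicit Defensive.

Import GroupScope.
Local Open Scope nat_scope.
Local Open Scope mset_scope.

(* Loopless: every edge has exactly two distinct ends; parallel edges are
   distinct elements of [edge] with the same ends. *)
Record multigraph := Multigraph {
  vertex : finType;
  edge : finType;
  ends : edge -> {set vertex};
  card_ends : forall e, #|ends e| = 2
}.

Section Flows.
Variable Gamma : multigraph.

(* [D e = (u, v)] means that [e] is oriented from its tail [u] to its head
   [v]. *)
Definition is_orientation (D : edge Gamma -> vertex Gamma * vertex Gamma) :
  Prop := forall e, ends e = [set (D e).1; (D e).2].

Definition is_flow (k : nat) (D : edge Gamma -> vertex Gamma * vertex Gamma)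
    (phi : edge Gamma -> int) : Prop :=
  [/\ is_orientation D,
      forall e, (`|phi e| < k%:Z)%R &
      forall v, (\sum_(e | (D e).1 == v) phi e =
                 \sum_(e | (D e).2 == v) phi e)%R].

Definition admits_nowhere_zero_flow (k : nat) : Prop :=
  exists (D : edge Gamma -> vertex Gamma * vertex Gamma)
         (phi : edge Gamma -> int),
    is_flow k D phi /\ forall e, phi e <> 0%R.

End Flows.

Definition squarefree (n : nat) : Prop := forall d, d ^ 2 %| n -> d = 1.

Section Cayley.
Variable gT : finGroupType.
Implicit Types (X : {mset gT}) (g h x : gT).

Definition connection_multiset X : Prop :=
  X 1%g = 0 /\ forall x, X x^-1%g = X x.

(* Each unordered pair {g, h} is represented by the ordered pair listing its
   elements in the order of [enum gT], so that it is counted only once; when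
   X is a connection multiset the choice of the order is immaterial, see
   [card_cay_edge]. *)
Definition cay_mult X (p : gT * gT) : nat :=
  if enum_rank p.1 < enum_rank p.2 then X (p.1^-1 * p.2)%g else 0.

Definition cay_edge X : finType := {p : gT * gT & 'I_(cay_mult X p)}.

Definition cay_ends X (e : cay_edge X) : {set gT} :=
  [set (tag e).1; (tag e).2].

Lemma cay_edge_lt X (e : cay_edge X) :
  enum_rank (tag e).1 < enum_rank (tag e).2.
Proof.
by case: e => p [i /=]; rewrite /cay_mult; case: ifP.
Qed.

Lemma card_cay_ends X (e : cay_edge X) : #|cay_ends e| = 2.
Proof.
rewrite cards2; have := cay_edge_lt e.
by case: eqP => // ->; rewrite ltnn.
Qed.

Definition Cay X : multigraph := Multigraph (@card_cay_ends X).

Lemma card_cay_edge X g h : connection_multiset X ->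
  #|[set e : edge (Cay X) | ends e == [set g; h]]| = X (g^-1 * h)%g.
Proof.
move=> [X1 XV].
have [<-|neq_gh] := eqVneq g h.
  rewrite mulVg X1; apply: eq_card0 => e; rewrite inE; apply/eqP => Ee.
  by have := card_ends e; rewrite Ee setUid cards1.
wlog lt_gh : g h neq_gh / enum_rank g < enum_rank h.
  move=> IH; have [|lt_hg|/val_inj/enum_rank_inj/eqP] :=
    ltngtP (enum_rank g) (enum_rank h); first exact: IH.
    by rewrite setUC IH // 1?eq_sym // -[in RHS]XV invMg invgK.
  by rewrite (negPf neq_gh).
have mE : cay_mult X (g, h) = X (g^-1 * h)%g by rewrite /cay_mult /= lt_gh.
rewrite -mE -[RHS]card_ord.
pose f (i : 'I_(cay_mult X (g, h))) : cay_edge X :=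
  Tagged (fun p => 'I_(cay_mult X p)) i.
have f_inj : injective f.
  by move=> i j /eqP; rewrite -tag_eqE /tag_eq /= eqxx tagged_asE => /eqP.
rewrite -(card_imset _ f_inj); apply: eq_card => e; rewrite inE.
apply/eqP/imsetP => [|[i _ ->] //].
have := cay_edge_lt e; case: e => [[a b] i] /= lt_ab Ee.
have /set2P Ha : a \in [set g; h] by rewrite -Ee set21.
have /set2P Hb : b \in [set g; h] by rewrite -Ee set22.
have [Ea Eb] : g = a /\ h = b.
  case: Ha Hb lt_ab => -> [] -> //; rewrite ?ltnn // => lt_hg.
  by have := ltn_trans lt_hg lt_gh; rewrite ltnn.
by subst a b; exists i.
Qed.

End Cayley.

(* Main.v *)
Require Import Defs.
From mathcomp Require Import all_boot all_order all_algebra all_fingroup all_solvable.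
From mathcomp Require Import zify.

Set Implicit Arguments.
Unset Strict Implicit.
Unset Printing Implicit Defensive.

Import Order.TTheory GRing.Theory Num.Theory.
Import GroupScope.
Local Open Scope nat_scope.
Local Open Scope mset_scope.

(** By Tutte, an orientation whose out-degrees and in-degrees agree modulo 3
    yields a nowhere-zero 3-flow.  Pairs {t, t^-1} and pairs of involutions can
    be oriented in a balanced way and dropped, so only valency 5 matters, where
    X consists of an odd number of involutions and of pairs {t, t^-1}.

    The derived subgroup C is cyclic, so its subgroups are normal in G; a flow
    lifts from G / N if N misses X, hence in a minimal counterexample X meets
    every subgroup of prime order of C.  Three constructions then suffice.
    - Three elements of X (closed under inversion) that all lie outside a
      subgroup of index 2 of the group they generate span a bipartite cubic
      graph.
    - If an involution a of X normalizes X, then right multiplication by a is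
      an automorphism, and one orients the 4-valent graph of the other elements
      so that this automorphism reverses all arcs and no vertex has out-degree
      2; the edges of a then restore the balance.  A parity argument gives odd
      out-degrees at all but one pair {v, v a}, which is repaired by reversing
      a cycle through v.
    - The remaining case is X = {a, x, x^-1, y, y^-1} with C = <x> of odd prime
      order, a inverting x, and w = a y^-1 generating a complement of C: one
      reverses the y-arcs leaving the elements of <w>. *)

(** * Groups whose derived subgroup has square-free order *)

Lemma squarefree_dvd m n : m %| n -> squarefree n -> squarefree m.
Proof. by move=> mn sf d dm; apply: sf; apply: dvdn_trans mn. Qed.

Lemma squarefree_prime_coprime p n : prime p -> squarefree (p * n) -> coprime p n.
Proof.
move=> p_pr sf; rewrite prime_coprime //; apply/negP => pn.
have E : p ^ 2 %| p * n by rewrite expnS expn1 dvdn_mul.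
by have := sf _ E; case: p p_pr {sf pn E} => [|[]].
Qed.

Lemma coprime_ltn_primes m n : 0 < n ->
  (forall p q, prime p -> prime q -> p %| m -> q %| n -> p < q) -> coprime m n.
Proof.
move=> n_gt0 lt_mn; rewrite /coprime eqn_leq gcdn_gt0 n_gt0 orbT andbT leqNgt.
apply/negP => gt1; have q_pr := pdiv_prime gt1; have := pdiv_dvd (gcdn m n).
rewrite dvdn_gcd => /andP[qm qn].
by have := lt_mn _ _ q_pr q_pr qm qn; rewrite ltnn.
Qed.

Section SquarefreeOrder.
Variable gT : finGroupType.
Implicit Type G : {group gT}.

(** [S] splits into blocks of generators of a common cyclic subgroup, and the block of [x] has
    [totient #[x]] elements. *)
Lemma dvdn_card_generators (S : {set gT}) k :
  (forall x y, x \in S -> <[x]> = <[y]> -> y \in S) ->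
  (forall x, x \in S -> k %| totient #[x]) -> k %| #|S|.
Proof.
move=> clS kS; rewrite -sum1_card (partition_big_imset (fun x => <[x]>)) /=.
apply: dvdn_sum => _ /imsetP[x Sx ->].
rewrite (_ : \sum_(_ in _ | _) 1 = totient #[x]); first exact: kS.
rewrite totient_gen -sum1_card; apply: eq_bigl => y; rewrite inE /generator.
rewrite eq_sym; apply: andb_idl => /eqP; exact: clS.
Qed.

(* Frobenius: the number of solutions of x ^ n = 1 is a multiple j * n of n;
   counting the elements of order divisible by p in blocks of generators of a
   cyclic group forces j = 1. *)
Lemma card_Ldiv_squarefree G m n : squarefree #|G| -> m * n = #|G| ->
  (forall p q, prime p -> prime q -> p %| m -> q %| n -> p < q) ->
  #|'Ldiv_n(G)| = n.
Proof.
move=> sfG; have [k le_mk] := ubnP m; elim: k => // k IHk in m n le_mk *.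
move=> mnG lt_mn.
have := cardG_gt0 G; rewrite -mnG muln_gt0 => /andP[m_gt0 n_gt0].
have [m1|m_gt1] := leqP m 1.
  have -> : n = #|G| by rewrite -mnG (_ : m = 1) ?mul1n //; lia.
  apply: eq_card => x; rewrite !inE; apply: andb_idr => Gx.
  by rewrite -order_dvdn order_dvdG.
have [p [p_pr /dvdnP[m' Em] p_max]] : exists p, [/\ prime p, p %| m
    & forall q, prime q -> q %| m -> q <= p].
  exists (max_pdiv m); split; [exact: max_pdiv_prime | exact: max_pdiv_dvd |].
  by move=> q q_pr qm; rewrite max_pdiv_max // mem_primes q_pr m_gt0.
have Em' : m' * (p * n) = #|G| by rewrite mulnA -Em.
have m'_gt0 : 0 < m' by move: m_gt0; rewrite Em muln_gt0 => /andP[].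
have p_gt1 := prime_gt1 p_pr.
have cpm' : coprime p m'.
  apply: squarefree_prime_coprime p_pr (squarefree_dvd _ sfG).
  by rewrite -mnG Em (mulnC p) dvdn_mulr.
have cpn : coprime p n.
  by apply: squarefree_prime_coprime p_pr (squarefree_dvd _ sfG); rewrite -Em' dvdn_mull.
(* Moving the largest prime [p] of [m] over to [n] keeps the primes of the first factor below those
   of the second, so induction applies. *)
have cardL : #|'Ldiv_(p * n)(G)| = p * n.
  apply: (IHk m') => //.
    have : m' < m by rewrite Em -{1}[m']muln1 ltn_pmul2l.
    by move: le_mk; lia.
  move=> p' q p'_pr q_pr p'm'; have p'm : p' %| m by rewrite Em dvdn_mulr.
  rewrite Euclid_dvdM // => /orP[|qn]; last exact: lt_mn p'm qn.
  rewrite dvdn_prime2 // => /eqP ->.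
  rewrite ltn_neqAle p_max // andbT.
  apply: contraTneq cpm' => <-.
  by rewrite prime_coprime // p'm'.
have sL : 'Ldiv_n(G) \subset 'Ldiv_(p * n)(G).
  apply/subsetP => x; rewrite !inE => /andP[-> /=].
  by rewrite -!order_dvdn => /dvdn_trans; apply; rewrite dvdn_mull.
have nG : n %| #|G| by rewrite -mnG dvdn_mull.
have [j Ej] := dvdnP (Frobenius_Ldiv nG).
set S := 'Ldiv_(p * n)(G) :\: 'Ldiv_n(G).
have cardS : #|S| = (p - j) * n.
  by rewrite cardsD (setIidPr sL) cardL Ej mulnBl.
have SE x : (x \in S) = [&& x \in G, #[x] %| p * n & ~~ (#[x] %| n)].
  rewrite !inE -!order_dvdn; case: (x \in G) => //=.
  by rewrite andbC.
have p1S : p.-1 %| #|S|.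
  apply: dvdn_card_generators => [x y|x].
    rewrite !SE => /and3P[Gx o1 o2] E.
    by rewrite -cycle_subG -E cycle_subG Gx orderE -E -orderE o1.
  rewrite SE => /and3P[Gx o1 o2].
  have /dvdnP[d Ed] : p %| #[x].
    apply: contraR o2 => npx; rewrite -(@Gauss_dvdr _ p) //.
    by rewrite coprime_sym prime_coprime.
  have cpd : coprime p d.
    apply: squarefree_prime_coprime p_pr (squarefree_dvd _ sfG).
    by rewrite mulnC -Ed order_dvdG.
  by rewrite Ed mulnC totient_coprime // totient_prime // dvdn_mulr.
have cp1n : coprime p.-1 n.
  apply: coprime_ltn_primes => // p' q p'_pr q_pr p'p qn.
  have /leq_ltn_trans -> // : p' <= p.
    by apply: leq_trans (dvdn_leq _ p'p) (leq_pred p); rewrite -ltnS prednK ?prime_gt0.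
  by apply: lt_mn => //; rewrite Em dvdn_mull.
have lt0S : 0 < #|S|.
  have pG : p %| #|G| by rewrite -mnG Em -mulnA dvdn_mull // dvdn_mulr.
  have [x Gx ox] := Cauchy p_pr pG.
  apply/card_gt0P; exists x; rewrite SE Gx ox dvdn_mulr //=.
  by rewrite -prime_coprime.
move: p1S lt0S; rewrite cardS Gauss_dvdl // => p1j.
rewrite muln_gt0 => /andP[lt0 _].
have := dvdn_leq lt0 p1j.
have j_gt0 : 0 < j.
  have : 0 < #|'Ldiv_n(G)| by apply/card_gt0P; exists 1%g; rewrite !inE group1 expg1n eqxx.
  by rewrite Ej muln_gt0 => /andP[].
(* [p - 1] divides the positive number [p - j], where [j > 0]. *)
move=> le; have Ej1 : j = 1 by lia.
by rewrite Ej Ej1 mul1n.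
Qed.

(** For the largest prime [p] there are exactly [p] solutions of [x ^ p = 1]; they form a cyclic
    subgroup, and automorphisms permute them. *)
Lemma squarefree_max_Sylow_char G : squarefree #|G| -> 1 < #|G| ->
  exists P : {group gT}, P \char G /\ #|P| = max_pdiv #|G|.
Proof.
move=> sfG G_gt1; set p := max_pdiv #|G|.
have p_pr : prime p := max_pdiv_prime G_gt1.
have [m] := dvdnP (max_pdiv_dvd #|G|); rewrite -/p => Em.
have cpm : coprime p m.
  by apply: squarefree_prime_coprime p_pr _; rewrite mulnC -Em.
have cL : #|'Ldiv_p(G)| = p.
  apply: (@card_Ldiv_squarefree G m p) => // p' q p'_pr q_pr p'm.
  rewrite dvdn_prime2 // => /eqP ->.
  rewrite ltn_neqAle max_pdiv_max ?andbT; last first.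
    by rewrite mem_primes p'_pr cardG_gt0 /= Em dvdn_mulr.
  by apply: contraTneq cpm => <-; rewrite prime_coprime // p'm.
have [x Gx ox] := Cauchy p_pr (max_pdiv_dvd #|G|).
have EL : <[x]> = 'Ldiv_p(G).
  apply/eqP; rewrite eqEcard cL -orderE ox leqnn andbT.
  apply/subsetP => y yx; rewrite !inE -order_dvdn -ox order_dvdG // andbT.
  by apply: subsetP yx; rewrite cycle_subG.
exists <[x]>%G; split; last by rewrite -orderE.
apply/charP; split; first by rewrite cycle_subG.
move=> f injf fG; apply/eqP; rewrite eqEcard card_injm ?cycle_subG // leqnn andbT.
apply/subsetP => _ /morphimP[y Gy xy ->]; rewrite /= EL in xy *.
move: xy; rewrite !inE => /andP[_ /eqP yp].
by rewrite -{2}fG mem_morphim //= -morphX // yp morph1.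
Qed.

Lemma squarefree_Zgroup G : squarefree #|G| -> Zgroup G.
Proof.
move=> sfG; apply/forall_inP => V /SylowP[p p_pr sylV].
have [k cV] := p_natP (pHall_pgroup sylV).
have sfV := squarefree_dvd (cardSg (pHall_sub sylV)) sfG.
have := prime_gt1 p_pr; case: k cV => [|[|k]] cV p_gt1.
- by rewrite (card1_trivg cV) cyclic1.
- by rewrite prime_cyclic // cV.
by have := sfV p; rewrite cV dvdn_exp2l // => /(_ isT) p1; rewrite p1 in p_gt1.
Qed.

End SquarefreeOrder.

(** Conjugation maps [G] into the abelian group [Aut P], so the derived subgroup lies in the
    kernel. *)
Lemma der1_sub_cent_cyclic (gT : finGroupType) (G P : {group gT}) :
  P <| G -> cyclic P -> G^`(1) \subset 'C(P).
Proof.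
move=> nPG cycP; have nP := normal_norm nPG.
have sDN : G^`(1) \subset 'N(P) := subset_trans (der_sub 1 G) nP.
rewrite -ker_conj_aut -sub_morphim_pre // morphim_der //.
rewrite (derG1P _) ?sub1G //.
exact: abelianS (Aut_conj_aut _ _) (Aut_cyclic_abelian cycP).
Qed.

(** Induction on [#|G|], modulo the subgroup [P] of largest prime order in the derived subgroup: the
    latter centralizes [P] and is cyclic modulo [P], hence abelian, and an abelian group with cyclic
    Sylow subgroups is cyclic. *)
Lemma cyclic_der1 (gT : finGroupType) (G : {group gT}) :
  squarefree #|G^`(1)| -> cyclic G^`(1).
Proof.
have [k] := ubnP #|G|; elim: k => // k IHk in gT G *.
move=> leGk sfD; have [D1|D_gt1] := leqP #|G^`(1)| 1.
  by rewrite (card_le1_trivg D1) cyclic1.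
have [P [chP cP]] := squarefree_max_Sylow_char sfD D_gt1.
have p_pr := max_pdiv_prime D_gt1; rewrite -cP in p_pr.
have nPG : P <| G := char_normal_trans chP (der_normal 1 G).
have cycQ : cyclic (G / P)^`(1).
  apply: IHk.
    rewrite -ltnS; apply: leq_trans leGk; rewrite ltnS ltn_quotient ?normal_sub //.
    by apply: contraTneq p_pr => ->; rewrite cards1.
  rewrite -quotient_der ?normal_norm //.
  apply: squarefree_dvd sfD; exact: dvdn_quotient.
have cPD : P \subset 'Z(G^`(1)).
  rewrite subsetI char_sub //= centsC.
  by apply: der1_sub_cent_cyclic nPG (prime_cyclic p_pr).
have abD : abelian G^`(1).
  apply: cyclic_factor_abelian cPD _.
  by rewrite quotient_der ?normal_norm.
exact: nil_Zgroup_cyclic (squarefree_Zgroup sfD) (abelian_nil abD).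
Qed.

(** * From modulo 3 to integer flows *)

Section IntegerFlow.
Local Open Scope ring_scope.
Variables (V E : finType) (src tgt : E -> V).
Implicit Types (phi : {ffun E -> bool}) (v : V).

(* [phi e] marks the arcs whose value 1 has been replaced by 1 - 3 = -2. *)
Let val phi e : int := if phi e then -2 else 1.
Let net phi v : int :=
  \sum_(e | src e == v) val phi e - \sum_(e | tgt e == v) val phi e.

Let flip phi e0 : {ffun E -> bool} := [ffun e => phi e (+) (e == e0)].

(** Residual graph: changing the value of one arc by 3 moves 3 units of [net] from [u] to [w]. *)
Let residual phi : rel V := fun u w =>
  [exists e, (src e == u) && (tgt e == w) && ~~ phi e
          || (src e == w) && (tgt e == u) && phi e].

Let sum_val phi e0 (f : E -> V) v :
  \sum_(e | f e == v) val (flip phi e0) e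
  = \sum_(e | f e == v) val phi e
    + (if f e0 == v then (if phi e0 then 3 else -3) else 0).
Proof.
rewrite big_mkcond [in RHS]big_mkcond /= (bigD1 e0) //= [in RHS](bigD1 e0) //=.
rewrite [RHS]addrAC; congr (_ + _); last first.
  apply: eq_bigr => e /negPf ne; by rewrite /val ffunE ne addbF.
by rewrite /val ffunE eqxx addbT; case: (f e0 == v); case: (phi e0).
Qed.

Let net_flip phi e0 v : net (flip phi e0) v =
  net phi v + (if phi e0 then 3 else -3) * ((src e0 == v)%:R - (tgt e0 == v)%:R).
Proof.
rewrite /net !sum_val; case: (src e0 == v); case: (tgt e0 == v);
  case: (phi e0); lia.
Qed.

(** The clause on unchanged arcs serves the induction: the first arc of the path ends at [v], which
    the rest of the path avoids, so the later flips do not touch it. *)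
Let augment phi v p : path (residual phi) v p -> uniq (v :: p) ->
  exists phi', (forall e, src e \notin v :: p \/ tgt e \notin v :: p -> phi' e = phi e)
    /\ forall w, net phi' w = net phi w + 3 * ((w == last v p)%:R - (w == v)%:R).
Proof.
elim: p v => [|u p IHp] v /=.
  by move=> _ _; exists phi; split=> // w; rewrite subrr mulr0 addr0.
move=> /andP[/existsP[e0 He0] up] /andP[vnot uniq_up].
have [phi' [agree net']] := IHp u up uniq_up.
have e0E : phi' e0 = phi e0.
  apply: agree; move: He0; case/orP=> /andP[/andP[/eqP -> /eqP ->] _]; [left|right] => //.
exists (flip phi' e0); split=> [e|w].
  move=> He; rewrite ffunE; have -> : (e == e0) = false.
    apply/eqP => Ee; move: He He0; rewrite Ee => He.
    by case/orP=> /andP[/andP[/eqP Es /eqP Et] _]; case: He;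
       rewrite ?Es ?Et !inE ?eqxx ?orbT.
  rewrite addbF; apply: agree; case: He; rewrite inE negb_or => /andP[_ ?]; by [left|right].
rewrite net_flip net' e0E (eq_sym _ w) (eq_sym _ w).
case/orP: He0 => /andP[/andP[/eqP -> /eqP ->]]; last by move=> ->; lia.
by move=> /negPf ->; lia.
Qed.

(** Among the assignments of 1 and -2 with all nets divisible by 3, one with least sum of absolute
    nets is a flow: an augmenting path from positive to negative net would lower this sum. *)
Lemma mod3_flow_int_flow :
  (forall v, (3 %| #|[set e | src e == v]|%:Z - #|[set e | tgt e == v]|%:Z)%Z) ->
  exists phi : E -> int, (forall e, phi e = 1 \/ phi e = -2)
    /\ forall v, \sum_(e | src e == v) phi e = \sum_(e | tgt e == v) phi e.
Proof.
move=> mod3.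
pose cost phi := (\sum_v `|net phi v|)%N.
pose ok phi := [forall v, (3 %| net phi v)%Z].
have net0 : ok [ffun=> false].
  have sumE (P : pred E) : \sum_(e | P e) val [ffun=> false] e = #|[set e | P e]|%:Z.
    rewrite (eq_bigr (fun=> 1)) => [|e _]; last by rewrite /val ffunE.
    by rewrite sumr_const natz; congr (Posz _); apply: eq_card => e; rewrite !inE.
  by apply/forallP => v; rewrite /net !sumE mod3.
case: (arg_minnP cost net0) => phi /forallP okphi phi_min.
exists (val phi); split=> [e|v]; first by rewrite /val; case: (phi e); [right|left].
suff net_le0 w : net phi w <= 0.
  have sum0 : \sum_w net phi w = 0.
    have sumE (f : E -> V) : \sum_u \sum_(e | f e == u) val phi e = \sum_e val phi e.
      by rewrite [RHS](partition_big f xpredT).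
    by rewrite sumrB !sumE subrr.
  have : \sum_w - net phi w = 0 by rewrite sumrN sum0 oppr0.
  move/eqP; rewrite psumr_eq0 => [|w _]; last by rewrite oppr_ge0.
  move/allP/(_ v); rewrite mem_index_enum => /(_ isT) /=.
  by rewrite oppr_eq0 subr_eq0 => /eqP.
rewrite leNgt; apply/negP => net_gt0.
have [/existsP[u /andP[wu net_lt0]]|noneg] :=
  boolP [exists u, connect (residual phi) w u && (net phi u < 0)].
  have [p0 pw0 lastp0] := connectP wu.
  move: lastp0; case/shortenP: pw0 => p pw uniq_p _ lastp.
  have [phi' [_ net']] := augment pw uniq_p; rewrite -lastp in net'.
  have uw : u != w by apply: contraTneq net_lt0 => ->; rewrite -leNgt ltW.
  have okphi' : ok phi'.
    apply/forallP => x; by rewrite net' rpredD // dvdz_mulr.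
  have := phi_min _ okphi'; rewrite leqNgt => /negP; apply.
  (* Both nets are nonzero multiples of 3, so the shift by 3 towards 0 lowers both absolute
     values. *)
  have divu := okphi u; have divw := okphi w.
  rewrite /cost (bigD1 u) //= (bigD1 w) 1?eq_sym //= [ltnRHS](bigD1 u) //= [in ltnRHS](bigD1 w) 1?eq_sym //=.
  rewrite !addnA.
  rewrite [X in (_ + X)%N](eq_bigr (fun x => `|net phi x|%N)).
    rewrite ltn_add2r !net' eqxx (negPf uw) eq_sym (negPf uw) eqxx.
    case/dvdzP: divu net_lt0 => k ->; case/dvdzP: divw net_gt0 => l ->. lia.
  by move=> x /andP[/negPf xu /negPf xw]; rewrite net' xu xw subrr mulr0 addr0.
(* Arcs leaving [R] have value -2 and arcs entering it have value 1, so the total net over [R] is at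
   most 0; yet no net in [R] is negative and that of [w] is positive. *)
pose R := [pred u | connect (residual phi) w u].
have : 0 < \sum_(u in R) net phi u.
  rewrite (bigD1 w) /=; last exact: connect0.
  apply: ltr_wpDr => //; apply: sumr_ge0 => u /andP[Ru _].
  rewrite leNgt; apply: contra noneg => lt0; apply/existsP; exists u.
  by rewrite -[connect _ _ _]/(u \in R) Ru.
apply/negP; rewrite -leNgt sumrB.
have part (f : E -> V) : \sum_(u in R) \sum_(e | f e == u) val phi e = \sum_(e | f e \in R) val phi e.
  rewrite (partition_big f (mem R)) //=; apply: eq_bigr => u Ru; apply: eq_bigl => e.
  by apply/idP/andP => [/eqP fe|[]//]; rewrite fe.
rewrite !part big_mkcond [X in _ - X]big_mkcond -sumrB /=.
apply: sumr_le0 => e _.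
case Rs: (src e \in R); case Rt: (tgt e \in R) => //.
- by rewrite subrr.
- rewrite subr0 /val; case: ifP => // nphi; move: Rt.
  have -> // : tgt e \in R.
  apply: connect_trans Rs (connect1 _); apply/existsP; exists e.
  by rewrite !eqxx nphi.
rewrite /val; case: ifP => // yphi; move: Rs.
have -> // : src e \in R.
apply: connect_trans Rt (connect1 _); apply/existsP; exists e.
by rewrite !eqxx yphi orbT.
Qed.

End IntegerFlow.

(** * Orientations of Cayley graphs *)

Section CayleyOrientation.
Variables (gT : finGroupType) (X : {mset gT}).
Hypothesis connX : connection_multiset X.

(* [o g x k] says that the k-th edge between [g] and [g * x] leaves [g]. *)
Definition cay_orientation (o : gT -> gT -> nat -> bool) :=
  forall g x k, k < X x -> o (g * x)%g x^-1%g k = ~~ o g x k.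

Definition cay_arc (o : gT -> gT -> nat -> bool) (e : edge (Cay X)) : gT * gT :=
  let p := tag e in
  if o p.1 (p.1^-1 * p.2)%g (tagged e) then p else (p.2, p.1).

Lemma cay_arc_is_orientation o : is_orientation (cay_arc o).
Proof.
move=> e; rewrite /= /cay_ends /cay_arc; case: ifP => //= _; exact: setUC.
Qed.

(** An edge is stored only at its ordered pair of increasing rank. The pairs ending at [v] are
    reread from the other end by means of [cay_orientation]. *)
Lemma cay_outdegree o v : cay_orientation o ->
  #|[set e | (cay_arc o e).1 == v]| = \sum_x \sum_(0 <= k < X x) o v x k.
Proof.
case: connX => X1 XV oV.
rewrite -sum1_card big_mkcond /=.
pose F (p : gT * gT) (k : nat) : nat :=
  (p.1 == v) * o p.1 (p.1^-1 * p.2)%g k + (p.2 == v) * ~~ o p.1 (p.1^-1 * p.2)%g k.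
have -> : \sum_e (if e \in [set e | (cay_arc o e).1 == v] then 1 else 0) =
          \sum_(e : edge (Cay X)) F (tag e) (tagged e).
  apply: eq_bigr => e _; rewrite inE /F /cay_arc.
  by case: (o _ _ _); case: eqP; case: eqP.
rewrite -(@sig_big_dep _ _ _ _ (fun p => 'I_(cay_mult X p)) xpredT
   (fun _ => xpredT) (fun p k => F p k)) /=.
rewrite -(pair_bigA _ (fun u w => \sum_(k < cay_mult X (u, w)) F (u, w) k)) /=.
pose G w := \sum_(0 <= k < X (v^-1 * w)%g) o v (v^-1 * w)%g k.
transitivity (\sum_w G w); last first.
  by rewrite (reindex_inj (mulgI v)); apply: eq_bigr => x _; rewrite /G mulKg.
have E u w : \sum_(k < cay_mult X (u, w)) F (u, w) k =
    (u == v) * ((enum_rank v < enum_rank w) * G w)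
    + (w == v) * ((enum_rank u < enum_rank v) * G u).
  rewrite -(big_mkord xpredT (fun k => F (u, w) k)) /F big_split -!big_distrr /=.
  rewrite /cay_mult /=; congr (_ + _).
    case: eqP => // ->; rewrite !mul1n /G.
    by case: ifP; rewrite ?mul1n // big_nil.
  case: eqP => // ->; rewrite !mul1n /G.
  case: ifP; rewrite ?mul1n ?big_nil // => _.
  have EV : (u^-1 * v)^-1%g = (v^-1 * u)%g by rewrite invMg invgK.
  rewrite -EV XV; apply: eq_big_nat => k /andP[_ kX].
  by rewrite -oV // mulKVg.
have delta (f : gT -> nat) : \sum_u (u == v) * f u = f v.
  by rewrite (bigD1 v) //= eqxx mul1n big1 ?addn0 // => u /negPf ->.
transitivity (\sum_u ((u == v) * \sum_w (enum_rank v < enum_rank w) * G w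
                      + (enum_rank u < enum_rank v) * G u)).
  apply: eq_bigr => u _; under eq_bigr => w _ do rewrite E.
  by rewrite big_split -big_distrr /= delta.
rewrite big_split /= (delta (fun=> _)) -big_split; apply: eq_bigr => w _ /=.
rewrite -mulnDl; have [_|_|lt] := ltngtP (enum_rank v) (enum_rank w); rewrite ?mul1n //.
by have /enum_rank_inj <- := val_inj lt; rewrite /G mulVg X1 big_nil muln0.
Qed.

(** The valency is the sum of out-degree and in-degree, so the congruence says that these agree
    modulo 3. In-degrees are out-degrees of the reversed orientation [o']. *)
Lemma cay_orientation_flow o : cay_orientation o ->
  (forall g, 2 * (\sum_x \sum_(0 <= k < X x) o g x k) = \sum_x X x %[mod 3]) ->
  admits_nowhere_zero_flow (Cay X) 3.
Proof.
move=> oV mod3; pose o' g x k := ~~ o g x k.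
have oV' : cay_orientation o' by move=> g x k kX; rewrite /o' oV.
have tgtE v : [set e | (cay_arc o e).2 == v] = [set e | (cay_arc o' e).1 == v].
  by apply/setP => e; rewrite !inE /cay_arc /o'; case: (o _ _ _).
have [|phi [phiE cons]] :=
  @mod3_flow_int_flow _ _ (fun e => (cay_arc o e).1) (fun e => (cay_arc o e).2).
  move=> v; rewrite tgtE !cay_outdegree //.
  have := mod3 v; set a := \sum_x _; set b := \sum_x X x; set c := \sum_x _.
  have : a + c = b.
    rewrite /a /b /c -big_split; apply: eq_bigr => x _ /=; rewrite -big_split /=.
    rewrite (eq_bigr (fun=> 1)) => [|k _]; first by rewrite sum_nat_const_nat muln1 subn0.
    by rewrite /o'; case: (o _ _ _).
  by clearbody a b c; clear; lia.
exists (cay_arc o), phi; split; last by move=> e; case: (phiE e) => ->.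
split=> [|e|v]; [exact: cay_arc_is_orientation | by case: (phiE e) => -> | exact: cons].
Qed.

End CayleyOrientation.

(** * Two-colorings of cosets *)

Section TwoColoring.
Variable gT : finGroupType.
Implicit Types (g h b d : gT) (K : {group gT}).

(** [K] has index 2 in [H], the group generated by [b] and [K]. The color of [g] tells whether [g]
    lies in the same left coset of [K] as the representative of its left coset of [H]. *)
Lemma coset_2coloring K b : b \notin K -> b \in 'N(K) -> (b ^+ 2)%g \in K ->
  exists chi : gT -> bool,
    (forall g k, k \in K -> chi (g * k)%g = chi g) /\
    (forall g h, (b^-1 * h)%g \in K -> chi (g * h)%g = ~~ chi g).
Proof.
move=> bK nKb b2K; pose H := (<[b]> <*> K)%G.
have HE h : h \in H -> (h \in K) || ((b^-1 * h)%g \in K).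
  rewrite /= norm_joinEl ?cycle_subG // => /mulsgP[_ k /cycleP[i ->] kK ->].
  rewrite -(odd_double_half i) expgD -mul2n expgM.
  have b2i : ((b ^+ 2) ^+ i./2)%g \in K by rewrite groupX.
  case: (odd i) => /=; last by rewrite expg0 mul1g groupM.
  by rewrite expg1 -!mulgA mulKg [X in _ || X]groupM ?orbT.
have disj h : h \in K -> (b^-1 * h)%g \in K -> False.
  move=> hK; rewrite groupMr // groupV; exact/negP.
have Hb : b \in H by rewrite /= mem_gen // inE cycle_id.
have sKH : K \subset H by rewrite /= joing_subr.
pose r g := repr (g *: H)%g.
have rH g : (g^-1 * r g)%g \in H by rewrite -mem_lcoset; apply: mem_repr (lcoset_refl _ _).
have rM g h : h \in H -> r (g * h)%g = r g.
  by move=> hH; rewrite /r lcosetM (lcoset_id hH).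
exists (fun g => (g^-1 * r g)%g \in K); split=> g h hK.
  by rewrite rM ?(subsetP sKH) // invMg -mulgA groupMl ?groupV.
have hH : h \in H.
  by rewrite -(mulKVg b h) groupM // (subsetP sKH).
rewrite rM // invMg -mulgA; set t := (g^-1 * r g)%g.
have -> : ((h^-1 * t)%g \in K) = ((b^-1 * t)%g \in K).
  by rewrite -(groupMl _ hK) -mulgA mulKVg.
apply/idP/idP => [bt|tK].
  by apply/negP => tK; exact: disj tK bt.
by have := HE _ (rH g); rewrite (negPf tK).
Qed.

Definition involution d := (d != 1%g) && (d ^+ 2 == 1)%g.

Lemma involutionV d : involution d -> d^-1%g = d.
Proof.
case/andP=> _ /eqP; rewrite expgS expg1 => dd; apply/eqP.
by rewrite eq_invg_mul dd.
Qed.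

(** The graph of [d] and [e] consists of even cycles. Formally, [d] normalizes [<[d * e]>] and is
    not in it: otherwise [d] and [e] commute, and that group contains at most 1 and [d * e]. *)
Lemma involution_2coloring d e : involution d -> involution e ->
  exists chi : gT -> bool, forall g,
    chi (g * d)%g = ~~ chi g /\ chi (g * e)%g = ~~ chi g.
Proof.
move=> Id Ie; have dV := involutionV Id; have eV := involutionV Ie.
have [d1 /eqP d2] := andP Id; have [e1 _] := andP Ie.
have dd : (d * d)%g = 1%g by rewrite -d2 expgS expg1.
have nK : d \in 'N(<[d * e]>).
  rewrite -groupV inE -cycleJ conjgE invgK cycle_subG !mulgA dd mul1g.
  by rewrite -{1}eV -invMg groupV cycle_id.
have [|||chi [_ chiN]] := @coset_2coloring <[d * e]>%G d; rewrite ?d2 ?group1 //.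
  have [<-|de] := eqVneq d e; first by rewrite dd /= cycle1 inE.
  apply/negP => dK; have cde : commute d e.
    have : commute d (d * e)%g by have := cycle_abelian (d * e)%g => /centsP; apply; rewrite ?cycle_id.
    by rewrite /commute -!mulgA => /mulgI.
  have de2 : ((d * e) ^+ 2)%g = 1%g.
    by rewrite expgMn // d2; have [_ /eqP ->] := andP Ie; rewrite mulg1.
  have /cycleP[i] := dK; rewrite -(odd_double_half i) expgD -mul2n expgM.
  rewrite de2 expg1n mulg1.
  case: (odd i) => /=; rewrite ?expg1 ?expg0 => E; last by rewrite E eqxx in d1.
  by case/eqP: e1; apply: (mulgI d); rewrite -E mulg1.
exists chi => g; split; apply: chiN; first by rewrite mulVg group1.
by rewrite dV cycle_id.
Qed.

End TwoColoring.

(** * Reduction to valency five *)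

Section Orientable.
Variable gT : finGroupType.
Implicit Types (a b c d x y g : gT).

(* The labels in S are involutions, each label in T stands for a pair
   {t, t^-1}; the out-degree minus the in-degree vanishes modulo 3. *)
Definition orientable (K : eqType) (e : K -> gT) (S T : seq K) :=
  exists A B : K -> gT -> bool,
    (forall i g, i \in S -> A i (g * e i)%g = ~~ A i g) /\
    forall g, 2 * (\sum_(i <- S) A i g + \sum_(j <- T) (B j g + ~~ B j (g * (e j)^-1)%g))
              = size S + 2 * size T %[mod 3].

(** In valency five, balance modulo 3 means out-degree 1 or 4. The numeral in the name counts the
    involutions. *)
Definition orientable1 a x y := exists A B C : gT -> bool,
  (forall g, A (g * a)%g = ~~ A g) /\
  forall g, (A g + (B g + ~~ B (g * x^-1)%g) + (C g + ~~ C (g * y^-1)%g)) %% 3 = 1.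

Definition orientable3 a b c x := exists A1 A2 A3 B : gT -> bool,
  (forall g, [/\ A1 (g * a)%g = ~~ A1 g, A2 (g * b)%g = ~~ A2 g & A3 (g * c)%g = ~~ A3 g]) /\
  forall g, (A1 g + A2 g + A3 g + (B g + ~~ B (g * x^-1)%g)) %% 3 = 1.

Definition orientable5 a b c d x := exists A1 A2 A3 A4 A5 : gT -> bool,
  (forall g, [/\ A1 (g * a)%g = ~~ A1 g, A2 (g * b)%g = ~~ A2 g, A3 (g * c)%g = ~~ A3 g,
              A4 (g * d)%g = ~~ A4 g & A5 (g * x)%g = ~~ A5 g]) /\
  forall g, (A1 g + A2 g + A3 g + A4 g + A5 g) %% 3 = 1.

Variables (K : eqType) (e : K -> gT).

(** The edges of [t] are directed along cycles, with one arc out of and one arc into each vertex. *)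
Lemma orientable_cons S T t : t \notin T -> orientable e S T -> orientable e S (t :: T).
Proof.
move=> tT [A [B [AV AB]]]; exists A, (fun j => if j == t then xpredT else B j).
split=> // g; rewrite big_cons eqxx /=.
rewrite [X in _ + (_ + X)](eq_big_seq (fun j => B j g + ~~ B j (g * (e j)^-1)%g)) => [|j jT].
  by have := AB g; lia.
by case: eqP jT tT => // -> ->.
Qed.

(** The even cycles of the two involutions become directed cycles. *)
Lemma orientable_cons2 S T i j : uniq [:: i, j & S] ->
  involution (e i) -> involution (e j) ->
  orientable e S T -> orientable e [:: i, j & S] T.
Proof.
rewrite /= inE negb_or => /and3P[/andP[ij iS] jS _] Ii Ij [A [B [AV AB]]].
have [chi chiN] := involution_2coloring Ii Ij.
exists (fun l => if l == i then chi else if l == j then fun g => ~~ chi g else A l), B.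
split=> [l g|g].
  rewrite !inE; case: eqP => [-> _|_]; first by case: (chiN g).
  by case: eqP => [-> _|_] /=; [case: (chiN g) => _ -> | exact: AV].
rewrite !big_cons eqxx eq_sym (negPf ij) eqxx.
rewrite [X in _ + (_ + X) + _](eq_big_seq (fun l => A l g : nat)) => [|l lS].
  by have := AB g; case: (chi g) => /=; lia.
by case: eqP lS iS => [-> ->//|_ lS _]; case: eqP lS jS => // -> ->.
Qed.

Lemma orientable_five (S T : seq K) : uniq S -> uniq T -> size S + 2 * size T = 5 ->
  (forall a x y : K, S = [:: a] -> T = [:: x; y] -> orientable1 (e a) (e x) (e y)) ->
  (forall a b c x : K, S = [:: a; b; c] -> T = [:: x] -> orientable3 (e a) (e b) (e c) (e x)) ->
  (forall a b c d x : K, S = [:: a; b; c; d; x] -> T = [::] ->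
     orientable5 (e a) (e b) (e c) (e d) (e x)) ->
  orientable e S T.
Proof.
case: S => [|a [|b [|c [|d [|x [|]]]]]]; case: T => [|y [|z [|]]] //=; try lia.
- move=> _; rewrite inE andbT => yz _ H _ _.
  have [//|//|A [B [C [AV AB]]]] := H a y z.
  exists (fun=> A), (fun l => if l == y then B else C); split=> [i g|g].
    by rewrite inE => /eqP ->.
  rewrite !big_cons !big_nil eqxx eq_sym (negPf yz).
  by case: (A g) (B g) (B (g * (e y)^-1)%g) (C g) (C (g * (e z)^-1)%g) (AB g) => [] [] [] [] [].
- rewrite !inE negb_or !andbT => /andP[/andP[ab ac] bc] _ _ _ H _.
  have [//|//|A [B [C [D [AV AB]]]]] := H a b c y.
  exists (fun l => if l == a then A else if l == b then B else C), (fun=> D); split=> [i g|g].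
    have [A1 A2 A3] := AV g; rewrite !inE; case: eqP => [->//|_].
    by case: eqP => [->//|_] /eqP ->.
  rewrite !big_cons !big_nil eqxx (eq_sym b) (negPf ab) eqxx !(eq_sym c) (negPf ac) (negPf bc).
  by case: (A g) (B g) (C g) (D g) (D (g * (e y)^-1)%g) (AB g) => [] [] [] [] [].
rewrite !inE !negb_or !andbT => /and4P[/and4P[ab ac ad ax] /and3P[bc bd bx] /andP[cd cx] dx].
move=> _ _ _ _ H.
have [//|//|A [B [C [D [E [AV AB]]]]]] := H a b c d x.
exists (fun l => if l == a then A else if l == b then B else if l == c then C else
  if l == d then D else E), (fun _ => xpredT); split=> [i g|g].
  have [A1 A2 A3 A4 A5] := AV g; rewrite !inE; do 4 (case: eqP => [->//|_]).
  by move=> /eqP ->.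
rewrite !big_cons !big_nil !eqxx (eq_sym b) (negPf ab).
rewrite !(eq_sym c) (negPf ac) (negPf bc) !(eq_sym d) (negPf ad) (negPf bd) (negPf cd).
rewrite !(eq_sym x) (negPf ax) (negPf bx) (negPf cx) (negPf dx).
by case: (A g) (B g) (C g) (D g) (E g) (AB g) => [] [] [] [] [].
Qed.

(** Each removal lowers the valency by 2. An odd valency above 5 descends to 5, where the recursion
    stops, and an even one to 0. *)
Lemma orientable_ge4 S T :
  (forall a x y, involution a -> x != 1%g -> y != 1%g -> orientable1 a x y) ->
  (forall a b c x, involution a -> involution b -> involution c -> x != 1%g ->
     orientable3 a b c x) ->
  (forall a b c d x, involution a -> involution b -> involution c -> involution d ->
     involution x -> orientable5 a b c d x) ->
  uniq S -> uniq T -> {in S, forall i, involution (e i)} ->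
  {in T, forall j, e j != 1%g} ->
  size S + 2 * size T \notin [:: 1; 3] -> orientable e S T.
Proof.
move=> H1 H3 H5; have [k] := ubnP (size S + size T).
elim: k => // k IHk in S T * => leSTk uS uT IS NT.
have [N5 _|N5] := eqVneq (size S + 2 * size T) 5.
  apply: orientable_five => // [a x y ES ET|a b c x ES ET|a b c d x ES ET]; subst S T.
  - by apply: H1; [apply: IS | apply: NT | apply: NT]; rewrite !inE eqxx ?orbT.
  - by apply: H3; [apply: IS | apply: IS | apply: IS | apply: NT]; rewrite !inE eqxx ?orbT.
  by apply: H5; apply: IS; rewrite !inE eqxx ?orbT.
case: T => [|t T] in leSTk uT NT N5 *.
  case: S => [|i [|j S]] in leSTk uS IS N5 * => //.
    move=> _; exists (fun _ => xpredT), (fun _ => xpredT); split=> // g.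
    by rewrite !big_nil.
  move=> N13; apply: orientable_cons2 => //; try by apply: IS; rewrite !inE eqxx ?orbT.
  apply: IHk => //=.
  - by move: leSTk; rewrite /=; lia.
  - by case/and3P: uS.
  - by move=> l lS; apply: IS; rewrite !inE lS !orbT.
  by move: N13 N5; rewrite /= !inE; lia.
move=> N13; case/andP: uT => tT uT; apply: orientable_cons => //; apply: IHk => //=.
- by move: leSTk; rewrite /=; lia.
- by move=> l lS; apply: NT; rewrite !inE lS !orbT.
by move: N13 N5; rewrite /= !inE; lia.
Qed.

End Orientable.

(** * From labelled generators to the edges of a Cayley graph *)

Section OrientableCayley.
Variables (gT : finGroupType) (X : {mset gT}).
Hypothesis connX : connection_multiset X.

Let rk (x : gT) : nat := enum_rank x.

Lemma sum_inverse_pairs (f : gT -> nat) :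
  \sum_x f x = \sum_(x | x^-1%g == x) f x + \sum_(x | rk x < rk x^-1%g) (f x + f x^-1%g).
Proof.
rewrite big_split /= (bigID (fun x => x^-1%g == x)) /=; congr (_ + _).
rewrite (bigID (fun x => rk x < rk x^-1%g)) /=; congr (_ + _).
  by apply: eq_bigl => x; case: eqP => // ->; rewrite ltnn.
rewrite (reindex_inj invg_inj) /=; apply: eq_bigl => x; rewrite invgK -leqNgt.
rewrite ltn_neqAle; congr (_ && _); congr (~~ _).
by apply/eqP/eqP => [{1}->//|/val_inj/enum_rank_inj].
Qed.

(** The copies of a repeated element receive distinct labels. *)
Let labels (P : pred gT) : seq (gT * nat) :=
  [seq (x, k) | x <- [seq x <- enum gT | P x], k <- iota 0 (X x)].
Let S := labels (fun x => x^-1%g == x).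
Let T := labels (fun x => rk x < rk x^-1%g).

Let mem_labels P x k : ((x, k) \in labels P) = P x && (k < X x).
Proof.
apply/allpairsPdep/andP => [[y [l [yP lX [-> ->]]]]|[Px kX]].
  by move: yP lX; rewrite mem_filter mem_iota => /andP[-> _].
by exists x, k; rewrite mem_filter Px mem_enum mem_iota.
Qed.

Let uniq_labels P : uniq (labels P).
Proof.
apply: allpairs_uniq_dep => [|x _|[x k] [y l] _ _ /= [<- <-]] //; last exact: iota_uniq.
by rewrite filter_uniq ?enum_uniq.
Qed.

Let sum_labels P (f : gT * nat -> nat) :
  \sum_(i <- labels P) f i = \sum_(x | P x) \sum_(0 <= k < X x) f (x, k).
Proof.
rewrite big_allpairs_dep big_filter big_enum_cond /=.
by apply: eq_bigr => x _; rewrite /index_iota subn0.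
Qed.

Let size_labels P : size (labels P) = \sum_(x | P x) X x.
Proof.
rewrite -sum1_size sum_labels; apply: eq_bigr => x _.
by rewrite sum_nat_const_nat subn0 muln1.
Qed.

Lemma orientable_Cay_flow :
  (forall a x y : gT, involution a -> x != 1%g -> y != 1%g -> orientable1 a x y) ->
  (forall a b c x : gT, involution a -> involution b -> involution c -> x != 1%g ->
     orientable3 a b c x) ->
  (forall a b c d x : gT, involution a -> involution b -> involution c -> involution d ->
     involution x -> orientable5 a b c d x) ->
  4 <= size X -> admits_nowhere_zero_flow (Cay X) 3.
Proof.
move=> H1 H3 H5 X_ge4; have [X1 XV] := connX.
have sizeX : size X = \sum_x X x.
  rewrite size_mset big_uniq ?fset_uniq //= big_mkcond; apply: eq_bigr => x _.
  by rewrite mem_finsupp; case: (X x).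
have sizeST : size S + 2 * size T = \sum_x X x.
  rewrite sum_inverse_pairs !size_labels; congr (_ + _).
  by rewrite big_distrr /=; apply: eq_bigr => x _; rewrite XV mul2n addnn.
have [|||||A [B [AV AB]]] := @orientable_ge4 _ _ fst S T H1 H3 H5; rewrite ?uniq_labels //.
- move=> [x k]; rewrite mem_labels => /andP[/eqP xV kX] /=.
  rewrite /involution expgS expg1 -{3}xV mulgV eqxx andbT.
  by apply: contraTneq kX => ->; rewrite X1.
- by move=> [x k]; rewrite mem_labels => /andP[_]; apply: contraTneq => /= ->; rewrite X1.
- by rewrite sizeST -sizeX !inE; move: X_ge4; case: (size X) => [|[|[|[]]]].
(* A pair [{x, x^-1}] is labelled by its element of smaller rank; for the other element the edge is
   read from its end [g * x]. *)
pose o g x k := if x^-1%g == x then A (x, k) g else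
  if rk x < rk x^-1%g then B (x, k) g else ~~ B (x^-1%g, k) (g * x)%g.
apply: (@cay_orientation_flow _ _ connX o) => [g x k kX|g].
  rewrite /o !invgK eq_sym; case: eqP => [xV|nV].
    by rewrite xV AV // mem_labels xV eqxx.
  case: ltngtP => [lt|lt|E]; rewrite ?mulgK ?negbK //.
  by case: nV; apply/enum_rank_inj/val_inj.
rewrite -sizeST -(AB g); congr ((2 * _) %% 3); rewrite sum_inverse_pairs !sum_labels.
congr (_ + _).
  by apply: eq_bigr => x xV; apply: eq_bigr => k _; rewrite /o xV.
apply: eq_bigr => x lt; rewrite XV -big_split; apply: eq_bigr => k _ /=.
have nV : (x^-1%g == x) = false by apply: contraTF lt => /eqP ->; rewrite ltnn.
by rewrite /o invgK nV (eq_sym x) nV lt ltnNge ltnW.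
Qed.

End OrientableCayley.

(** * Involutions normalizing the connection set *)

Lemma connect_closed_ind (T : finType) (r : rel T) (P : T -> Prop) x y :
  P x -> (forall z t, P z -> r z t -> P t) -> connect r x y -> P y.
Proof.
move=> Px Pr /connectP[p]; elim: p x Px => [|z p IHp] x Px /= => [_ -> //|].
by case/andP=> /(Pr _ _ Px) Pz; apply: IHp.
Qed.

Lemma odd_card_addb (I : finType) (P : pred I) :
  odd #|[set i | P i]| = \big[addb/false]_i P i.
Proof.
rewrite -sum1_card big_mkcond /= (big_morph odd oddD (erefl _)).
by apply: eq_bigr => i _; rewrite inE; case: (P i).
Qed.

Section NormalizingInvolution.
Variables (gT : finGroupType) (a : gT) (I : finType) (e : I -> gT) (iota pi : I -> I).
Hypotheses (Ia : involution a) (cardI : #|I| = 4).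
Hypotheses (iotaK : involutive iota) (piK : involutive pi).
Hypothesis iota_pi : forall i, iota (pi i) = pi (iota i).
Hypothesis e_iota : forall i, e (iota i) = (e i)^-1%g.
Hypothesis e_pi : forall i, e (pi i) = (e i ^ a)%g.
Hypotheses (e1 : forall i, e i != 1%g) (ea : forall i, e i != a).
Hypothesis genG : <<a |: [set e i | i : I]>> = [set: gT].
Implicit Types (g h u v w : gT) (o : gT -> I -> bool).

Let aa : (a * a)%g = 1%g.
Proof. by case/andP: Ia => _ /eqP; rewrite expgS expg1. Qed.

Let gaa g : (g * a * a)%g = g.
Proof. by rewrite -mulgA aa mulg1. Qed.

Let eqa g h : (g * a == h)%g = (g == h * a)%g.
Proof. by apply/eqP/eqP => [<-|->]; rewrite gaa. Qed.

Let a_neq1 g : (g * a == g)%g = false.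
Proof. by rewrite -{2}[g]mulg1 (inj_eq (mulgI g)); case/andP: Ia => /negPf. Qed.

Let ae_pi i : (a * e (pi i))%g = (e i * a)%g.
Proof. by rewrite e_pi conjgE !mulgA mulgV mul1g. Qed.

Let ee i : (e i * e (iota i))%g = 1%g. Proof. by rewrite e_iota mulgV. Qed.

(** A pair [(g, i)] is a dart, an edge with a chosen end [g]. The map [rev] passes to the other end,
    and [tau] is the action of right multiplication by [a]. *)
Let rev (d : gT * I) := (d.1 * e d.2, iota d.2)%g.
Let tau (d : gT * I) := (d.1 * a, pi d.2)%g.

Let revK : involutive rev.
Proof. by case=> g i; rewrite /rev /= iotaK -mulgA ee mulg1. Qed.
Let tauK : involutive tau.
Proof. by case=> g i; rewrite /tau /= piK gaa. Qed.
Let revtau d : rev (tau d) = tau (rev d).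
Proof. by case: d => g i; rewrite /rev /tau /= iota_pi -!mulgA ae_pi. Qed.

Definition skew_orientation o := forall g i,
  o (g * e i)%g (iota i) = ~~ o g i /\ o (g * a)%g (pi i) = ~~ o g i.

Let skew_rev_tau (f : gT * I -> bool) :
  (forall d, f (rev d) = ~~ f d) -> (forall d, f (tau d) = ~~ f d) ->
  skew_orientation (fun g i => f (g, i)).
Proof. by move=> frev ftau g i; split; [rewrite -frev | rewrite -ftau]. Qed.

(** [rho] takes the same value at [d] and [tau (rev d)], and another value at [rev d] and [tau d];
    so both [rev] and [tau] reverse the comparison. *)
Lemma skew_orientation_exists : exists o, skew_orientation o.
Proof.
pose r (d : gT * I) : nat := enum_rank d.
pose rho d := minn (r d) (r (tau (rev d))).
have rho_tau d : rho (tau d) = rho (rev d).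
  by rewrite /rho revtau tauK revK minnC.
have rho_neq d : rho d != rho (rev d).
  have neq d1 d2 : d1 != d2 -> r d1 != r d2.
    by apply: contraNneq => /val_inj/enum_rank_inj ->.
  have n1 : r d != r (rev d).
    apply: neq; case: d => g i; apply/eqP => -[/esym/eqP].
    by rewrite -{2}[g]mulg1 (inj_eq (mulgI g)) (negPf (e1 i)).
  have n2 : r d != r (tau d).
    by apply: neq; apply/eqP => /(congr1 fst)/esym/eqP; rewrite a_neq1.
  have n3 : r (tau (rev d)) != r (rev d).
    by apply: neq; rewrite -revtau; apply: contraTneq n2 => /(inv_inj revK) ->; rewrite eqxx.
  have n4 : r (tau (rev d)) != r (tau d).
    apply: neq; apply: contraTneq n1 => /(inv_inj tauK) E.
    by rewrite E eqxx.
  rewrite /rho revK; case: (leqP (r d)) => _; case: (leqP (r (rev d))) => _ //.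
exists (fun g i => rho (g, i) < rho (rev (g, i))).
have frev d : (rho (rev d) < rho (rev (rev d))) = ~~ (rho d < rho (rev d)).
  by rewrite revK -leqNgt ltn_neqAle eq_sym rho_neq.
apply: (@skew_rev_tau (fun d => rho d < rho (rev d))) => // d.
by rewrite revtau !rho_tau revK -leqNgt ltn_neqAle eq_sym rho_neq.
Qed.

(** The four darts form the orbit of [d] under [rev] and [tau], so that skewness survives. *)
Let flip o (d : gT * I) g i :=
  o g i (+) ((g, i) == d) (+) ((g, i) == rev d) (+) ((g, i) == tau d) (+) ((g, i) == tau (rev d)).

Let flip_skew o d : skew_orientation o -> skew_orientation (flip o d).
Proof.
move=> so; pose f d' := o d'.1 d'.2 (+) (d' == d) (+) (d' == rev d) (+) (d' == tau d)
  (+) (d' == tau (rev d)).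
have srev d' : o (rev d').1 (rev d').2 = ~~ o d'.1 d'.2 by case: (so d'.1 d'.2).
have stau d' : o (tau d').1 (tau d').2 = ~~ o d'.1 d'.2 by case: (so d'.1 d'.2).
apply: (@skew_rev_tau f) => d'; rewrite /f ?srev ?stau.
  rewrite (can2_eq revK revK) (inj_eq (inv_inj revK)) !(can2_eq revK revK) revtau revtau revK.
  by case: (o _ _); case: (_ == d); case: (_ == rev d); case: (_ == tau d); case: (_ == tau _).
rewrite (can2_eq tauK tauK) (can2_eq tauK tauK) (inj_eq (inv_inj tauK)) (inj_eq (inv_inj tauK)).
by case: (o _ _); case: (_ == d); case: (_ == rev d); case: (_ == tau d); case: (_ == tau _).
Qed.

Let par o g := \big[addb/false]_i o g i.
Let cls u g := (g == u) (+) (g == u * a)%g.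

Let par_flip o u i g : par (flip o (u, i)) g = par o g (+) cls u g (+) cls (u * e i)%g g.
Proof.
rewrite /par /flip !big_split /=.
have delta (d : gT * I) : \big[addb/false]_j ((g, j) == d) = (g == d.1).
  rewrite (bigD1 d.2) //= big1 ?addbF => [|j /negPf nj].
    by rewrite -pair_eqE /= eqxx andbT.
  by rewrite -pair_eqE /= nj andbF.
rewrite !delta -/(par o g) /cls /=.
case: (par o g); case: (g == u); case: (g == u * a)%g; case: (g == u * e i)%g;
by case: (g == _)%g.
Qed.

Let step (W : pred gT) g h :=
  [&& ~~ W g, ~~ W h & (h == g * a)%g || [exists i, h == g * e i]%g].

Let step_sym W : symmetric (step W).
Proof.
move=> g h; apply/idP/idP => /and3P[Wg Wh /orP[/eqP E|/existsP[i /eqP E]]];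
  rewrite /step Wg Wh /= E ?gaa ?eqxx //; apply/orP; right;
  by apply/existsP; exists (iota i); rewrite -mulgA ee mulg1.
Qed.

(** Each flip changes the parities on the classes [{g, g * a}] of both ends of an edge, so inner
    changes cancel. A step by [a] stays in its class and needs no flip. *)
Let path_flip (W : pred gT) u v o : (forall g, W (g * a)%g = W g) ->
  skew_orientation o -> connect (step W) u v ->
  exists o', [/\ skew_orientation o', forall g i, W g -> o' g i = o g i
    & forall g, par o' g = par o g (+) cls u g (+) cls v g].
Proof.
move=> Wa so uv.
pattern v; apply: connect_closed_ind uv => [|z t [o' [so' oW po]] /and3P[Wz Wt zt]].
  by exists o; split=> // g; rewrite -addbA addbb addbF.
case/orP: zt => [/eqP Et|/existsP[i /eqP Et]].
  exists o'; split=> // g; rewrite po /cls Et gaa.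
  by rewrite [(g == z) (+) _]addbC.
exists (flip o' (z, i)); split=> [|g j Wg|g]; first exact: flip_skew.
  have neq h : ~~ W h -> (g == h) = false by apply: contraNF => /eqP <-.
  rewrite -oW // /flip /tau /rev /= -!pair_eqE /= !neq ?Wa // -?Et //.
  by rewrite !addbF.
rewrite par_flip po -Et; case: (par o g); case: (cls u g); case: (cls z g); by case: (cls t g).
Qed.

Let conn_all u v : connect (step pred0) u v.
Proof.
pose H := [set h | [forall g, connect (step pred0) g (g * h)%g]].
have gH : group_set H.
  apply/group_setP; split=> [|x y]; rewrite !inE.
    by apply/forallP => g; rewrite mulg1 connect0.
  move=> /forallP Hx /forallP Hy; apply/forallP => g.
  by rewrite mulgA; apply: connect_trans (Hx g) (Hy _).
have : [set: gT] \subset Group gH.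
  rewrite -genG gen_subG; apply/subsetP => x; rewrite !inE => xa.
  apply/forallP => g; apply: connect1; rewrite /step /=.
  case/orP: xa => [/eqP ->|/imsetP[i _ ->]]; first by rewrite eqxx.
  by apply/orP; right; apply/existsP; exists i.
move=> /subsetP/(_ (u^-1 * v)%g); rewrite !inE => /(_ isT)/forallP/(_ u).
by rewrite mulKVg.
Qed.

Let cla v : pred gT := [pred g | (g == v) || (g == v * a)%g].

Let cla_a v g : cla v (g * a)%g = cla v g.
Proof. by rewrite /cla /= !eqa gaa orbC. Qed.

Let cla_sym v g : cla v g = cla g v.
Proof. by rewrite /cla /= eq_sym [(g == _)]eq_sym eqa. Qed.

(* Take v0 and w such that the component of w in the graph without v0 is as
   large as possible. *)
Let noncut_vertex : exists v0, forall g h, ~~ cla v0 g -> ~~ cla v0 h ->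
  connect (step (cla v0)) g h.
Proof.
have [i0 _] : exists i0 : I, true by have /card_gt0P[i _] : 0 < #|I|; [rewrite cardI | exists i].
pose comp (p : gT * gT) := [set z | connect (step (cla p.1)) p.2 z].
have P0 : ~~ cla (1%g : gT, e i0).1 (1%g : gT, e i0).2.
  by rewrite /cla /= mul1g negb_or e1 ea.
have [[v0 w] /= v0w maxw] := arg_maxnP (fun p => #|comp p|) (P0 : (fun p => ~~ cla p.1 p.2) (1%g, e i0)).
exists v0.
have csym := sym_connect_sym (@step_sym (cla v0)).
suff all u : ~~ cla v0 u -> connect (step (cla v0)) w u.
  by move=> g h Hg Hh; apply: connect_trans (all h Hh); rewrite csym all.
move=> v0u; apply/negPn/negP => nwu.
have compN z : connect (step (cla v0)) w z -> ~~ cla v0 z.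
  by move=> wz; pattern z; apply: connect_closed_ind wz => // ? ? _ /and3P[].
have compu z : connect (step (cla v0)) w z -> ~~ cla u z.
  move=> wz; apply/negP => /orP[/eqP E|/eqP E]; first by rewrite E (negPf nwu) in wz.
  case/negP: nwu; apply: (connect_trans wz (connect1 _)).
  by rewrite /step v0u E cla_a v0u gaa eqxx.
have sub z : connect (step (cla v0)) w z -> connect (step (cla u)) w z.
  move=> wz; suff [] : connect (step (cla v0)) w z /\ connect (step (cla u)) w z by [].
  pattern z; apply: connect_closed_ind wz => [|y t [wy wy'] yt]; first by split; exact: connect0.
  have wt := connect_trans wy (connect1 yt); split=> //.
  apply: connect_trans wy' (connect1 _); rewrite /step !compu //.
  by case/and3P: yt.
have uw : ~~ cla u w by apply: compu; exact: connect0.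
(* An edge leaving the component of [w] must end in the class of [v0]. Deleting the class of [u]
   instead keeps this component and adds [t], against maximality. *)
have /existsP[z /existsP[t /and3P[wz zt nwt]]] : [exists z, exists t,
    [&& connect (step (cla v0)) w z, step pred0 z t & ~~ connect (step (cla v0)) w t]].
  apply: contraT => /existsPn none.
  have : ~~ cla v0 v0; last by rewrite /cla /= eqxx.
  apply: compN; pattern v0 at 2; apply: connect_closed_ind (conn_all w v0) => [|y t wy yt]; first exact: connect0.
  by have /existsPn/(_ t) := none y; rewrite wy yt /= negbK.
have v0t : cla v0 t.
  apply: contraNT nwt => v0t; apply: (connect_trans wz (connect1 _)).
  by apply/and3P; split; [exact: (compN _ wz) | exact: v0t | case/and3P: zt].
have ut : ~~ cla u t.
  by case/orP: v0t => /eqP ->; rewrite ?cla_a cla_sym.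
have wt : connect (step (cla u)) w t.
  apply: (connect_trans (sub _ wz) (connect1 _)).
  by apply/and3P; split; [exact: (compu _ wz) | exact: ut | case/and3P: zt].
have := maxw (u, w) uw; rewrite /= leqNgt => /negP; apply.
apply: proper_card; apply/properP; split.
  by apply/subsetP => y; rewrite !inE /=; apply: sub.
by exists t; rewrite inE.
Qed.

(** The out-degrees at [g] and [g * a] add up to 4, so they have equal parity. Flips along paths
    ending at [v0] make all of them odd outside the class of [v0]. *)
Lemma skew_orientation_unbalanced :
  exists o, skew_orientation o /\ forall g, #|[set i | o g i]| != 2.
Proof.
have [v0 v0conn] := noncut_vertex.
have card_a o g : skew_orientation o -> #|[set i | o (g * a)%g i]| = 4 - #|[set i | o g i]|.
  move=> so; have -> : [set i | o (g * a)%g i] = pi @: ~: [set i | o g i].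
    apply/setP => i; rewrite -{2}[i]piK mem_imset; last exact: inv_inj.
    by rewrite !inE -{1}[i]piK (so g (pi i)).2.
  by rewrite card_imset; [rewrite cardsCs setCK cardI | exact: inv_inj].
have parE o g : par o g = odd #|[set i | o g i]| by rewrite odd_card_addb.
have le4 o g : #|[set i | o g i]| <= 4 by rewrite -cardI max_card.
have par_a o g : skew_orientation o -> par o (g * a)%g = par o g.
  by move=> so; rewrite !parE card_a // oddB.
have [o [so po]] : exists o, skew_orientation o /\ forall g, ~~ cla v0 g -> par o g.
  pose bad o := [set g | ~~ par o g & ~~ cla v0 g].
  have [o so] := skew_orientation_exists.
  have [k] := ubnP #|bad o|; elim: k => // k IHk in o so *.
  have [bad0 _|[g bg] lt] := set_0Vmem (bad o).
    exists o; split=> // g ng; apply/negPn/negP => npar.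
    by have := in_set0 g; rewrite -bad0 inE npar ng.
  have [//|o' [so' _ po']] := path_flip (W := pred0) _ so (conn_all g v0).
  apply: (IHk o' so'); move: lt; rewrite ltnS; apply: leq_trans.
  apply: proper_card; apply/properP; have := bg; rewrite inE => /andP[npg ng].
  have po'E h : ~~ cla v0 h -> par o' h = par o h (+) cls g h.
    by rewrite po' negb_or => /andP[/negPf n1 /negPf n2]; rewrite {2}/cls n1 n2 !addbF.
  split; last by exists g; rewrite // inE po'E // /cls eqxx -eqa a_neq1 (negPf npg).
  apply/subsetP => h; rewrite !inE => /andP[nph nh]; rewrite nh andbT.
  move: nph; rewrite po'E // /cls; case: eqP => [->|_]; first by rewrite (negPf npg).
  by case: eqP => [->|_]; rewrite ?par_a ?(negPf npg) ?addbF.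
have odd2 o' g : par o' g -> #|[set i | o' g i]| != 2.
  by rewrite parE; apply: contraTneq => ->.
have fin o' : skew_orientation o' -> (forall g, ~~ cla v0 g -> par o' g) ->
    #|[set i | o' v0 i]| != 2 ->
    exists o, skew_orientation o /\ forall g, #|[set i | o g i]| != 2.
  move=> so' po' v2; exists o'; split=> // g.
  have [|/po'] := boolP (cla v0 g); last exact: odd2.
  case/orP=> /eqP -> //; rewrite card_a //; have := le4 o' v0; move: v2.
  by case: #|_| => [|[|[|[|[]]]]].
have [/cards2P[i1 [i2 [ni oE]]]|] := boolP (#|[set i | o v0 i]| == 2); last exact: fin.
have ncla i : ~~ cla v0 (v0 * e i)%g.
  rewrite /cla /= negb_or (inj_eq (mulgI v0)) ea andbT.
  by rewrite -{2}[v0]mulg1 (inj_eq (mulgI v0)) e1.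
have [o' [so' oW po']] := path_flip (@cla_a v0) so (v0conn _ _ (ncla i1) (ncla i2)).
(* The path is closed up by the two arcs leaving [v0], so no parity changes. As the path avoids the
   class of [v0], exactly these two arcs are reversed at [v0], and its out-degree drops from 2 to
   0. *)
pose o2 := flip (flip o' (v0, i1)) (v0, i2).
apply: (fin o2); first by do 2 apply: flip_skew.
  move=> g ng; have := po g ng; rewrite !par_flip po'.
  by case: (par o g); case: (cls v0 g); case: (cls _ g); case: (cls _ g).
suff -> : [set i | o2 v0 i] = set0 by rewrite cards0.
apply/setP => i; rewrite !inE.
have v0e j : (v0 == v0 * e j)%g = false.
  by apply: contraNF (ncla j) => /eqP <-; rewrite /cla /= eqxx.
have v0ea j : (v0 == v0 * e j * a)%g = false.
  by apply: contraNF (ncla j) => E; rewrite /cla /= -eqa eq_sym in E *; rewrite E orbT.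
rewrite /o2 /flip /tau /rev /= -!pair_eqE /= !v0e !v0ea (eq_sym v0) a_neq1 eqxx /= !addbF.
rewrite oW /cla /= ?eqxx //.
have -> : o v0 i = (i \in [set i1; i2]) by rewrite -oE inE.
by rewrite !inE; case: eqP => [->|_]; [rewrite (negPf ni) | case: (i == i2)].
Qed.

End NormalizingInvolution.

(** * Criteria in valency five *)

Lemma card_bool2 (P : pred (bool * bool)) :
  #|[set i | P i]| = P (true, true) + P (true, false) + (P (false, true) + P (false, false)).
Proof.
rewrite -sum1_card big_mkcond /=.
rewrite (eq_bigr (fun p => P (p.1, p.2) : nat)) => [|[i j] _]; last by rewrite inE; case: (P _).
by rewrite -(pair_bigA _ (fun i j => P (i, j) : nat)) /= !big_bool.
Qed.

Section Criteria.
Variable gT : finGroupType.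
Implicit Types (a b c d x y g : gT).

Lemma mulgVK_flip (B : gT -> bool) x : (forall g, B (g * x)%g = ~~ B g) ->
  forall g, B (g * x^-1)%g = ~~ B g.
Proof. by move=> Bx g; rewrite -[in RHS](mulgKV x g) Bx negbK. Qed.

Lemma orientable1_normalizing a x y : involution a ->
  x != 1%g -> y != 1%g -> x != a -> y != a ->
  (x ^ a)%g \in [:: x; x^-1%g] -> (y ^ a)%g \in [:: y; y^-1%g] ->
  <<[set a; x; y]>> = [set: gT] -> orientable1 a x y.
Proof.
move=> Ia x1 y1 xa ya xJ yJ genG; have aV := involutionV Ia.
pose z (s : bool) := if s then x else y.
pose e (i : bool * bool) := if i.2 then z i.1 else (z i.1)^-1%g.
pose f s := (z s ^ a != z s)%g.
pose iota (i : bool * bool) := (i.1, ~~ i.2).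
pose pi (i : bool * bool) := (i.1, i.2 (+) f i.1).
have zJ s : (z s ^ a)%g = if f s then (z s)^-1%g else z s.
  have : (z s ^ a)%g \in [:: z s; (z s)^-1%g] by case: s.
  by rewrite !inE /f; case: eqP => //= _ /eqP.
have [|||||||||o [so ubal]] := @skew_orientation_unbalanced _ a _ e iota pi Ia.
- by rewrite card_prod card_bool.
- by case=> s t; rewrite /iota /= negbK.
- by case=> s t; rewrite /pi /= -addbA addbb addbF.
- by case=> s t; rewrite /iota /pi /= addNb.
- by case=> s [] //; rewrite /e /= ?invgK.
- case=> s t; rewrite /e /=; case: t => /=; rewrite ?conjVg zJ; case: (f s) => //.
  by rewrite invgK.
- by case=> [] [] []; rewrite /e /z //= ?invg_eq1.
- case=> [] [] []; rewrite /e /z //=; by rewrite -aV (inj_eq invg_inj).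
- apply/eqP; rewrite eqEsubset subsetT /= -genG gen_subG; apply/subsetP => h.
  rewrite !inE => /orP[/orP[]|] /eqP ->; rewrite mem_gen // !inE ?eqxx //.
    by apply/orP; right; apply/imsetP; exists (true, true).
  by apply/orP; right; apply/imsetP; exists (false, true).
pose n g := #|[set i | o g i]|.
(* The edge of [a] raises out-degrees 0 and 3 to 1 and 4, and leaves 1 and 4 alone. This is
   consistent because [n (g * a)] is [4 - n g]. *)
exists (fun g => (n g == 0) || (n g == 3)), (fun g => o g (true, true)),
  (fun g => o g (false, true)).
have oV s g : (~~ o (g * (z s)^-1)%g (s, true)) = o g (s, false).
  by rewrite -(so _ (s, true)).1 /e /= mulgKV.
split=> g.
  have := ubal g; have := so g; rewrite /n !card_bool2 => sog.
  have E s : o (g * a)%g (s, true) + o (g * a)%g (s, false)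
    = ~~ o g (s, true) + ~~ o g (s, false).
    rewrite -(sog (s, true)).2 -(sog (s, false)).2 /pi /=.
    by case: (f s) => //; rewrite addnC.
  rewrite !E; by case: (o g _); case: (o g _); case: (o g _); case: (o g _).
have := ubal g; rewrite /n card_bool2 (oV true) (oV false).
by case: (o g _); case: (o g _); case: (o g _); case: (o g _).
Qed.

Lemma orientable3_central a b c x : involution a -> involution b -> involution c ->
  x != 1%g -> b != a -> c != a -> x != a ->
  commute b a -> commute c a -> commute x a ->
  <<[set a; b; c; x]>> = [set: gT] -> orientable3 a b c x.
Proof.
move=> Ia Ib Ic x1 ba ca xa cb cc cx genG; have aV := involutionV Ia.
have bV := involutionV Ib; have cV := involutionV Ic.
have [b1 _] := andP Ib; have [c1 _] := andP Ic.
pose e (i : bool * bool) :=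
  if i.1 then (if i.2 then x else x^-1%g) else (if i.2 then b else c).
(* Inversion exchanges the labels of [x] and [x^-1] and fixes those of [b] and [c]; conjugation by
   [a] fixes all four. *)
pose iota (i : bool * bool) := (i.1, i.1 (+) i.2).
have eJ h : commute h a -> (h ^ a)%g = h by move=> ch; rewrite conjgE ch mulKg.
have [|||||||||o [so ubal]] := @skew_orientation_unbalanced _ a _ e iota id Ia.
- by rewrite card_prod card_bool.
- by case=> s t; rewrite /iota /= addbA addbb.
- by [].
- by [].
- by case=> [] [] []; rewrite /e /= ?invgK.
- by case=> [] [] []; rewrite /e /= ?conjVg eJ.
- by case=> [] [] []; rewrite /e //= ?invg_eq1.
- case=> [] [] []; rewrite /e //=; by rewrite -aV (inj_eq invg_inj).
- apply/eqP; rewrite eqEsubset subsetT /= -genG gen_subG; apply/subsetP => h.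
  rewrite !inE => /orP[/orP[/orP[]|]|] /eqP ->; rewrite mem_gen // !inE ?eqxx //;
    apply/orP; right; apply/imsetP.
  + by exists (false, true).
  + by exists (false, false).
  by exists (true, true).
pose n g := #|[set i | o g i]|.
exists (fun g => (n g == 0) || (n g == 3)), (fun g => o g (false, true)),
  (fun g => o g (false, false)), (fun g => o g (true, true)).
split=> g.
  split; [|exact: (so g (false, true)).1|exact: (so g (false, false)).1].
  have := ubal g; rewrite /n !card_bool2 !(so g _).2.
  by case: (o g _); case: (o g _); case: (o g _); case: (o g _).
have -> : (~~ o (g * x^-1)%g (true, true)) = o g (true, false).
  by rewrite -(so _ (true, true)).1 /e /= mulgKV.
have := ubal g; rewrite /n card_bool2.
by case: (o g _); case: (o g _); case: (o g _); case: (o g _).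
Qed.

Lemma orientable1C a x y : orientable1 a x y -> orientable1 a y x.
Proof.
by case=> A [B [C [AV AB]]]; exists A, C, B; split=> // g; rewrite addnAC.
Qed.

Lemma orientable3C a b c x : orientable3 a b c x -> orientable3 b a c x.
Proof.
case=> A [B [C [D [AV AB]]]]; exists B, A, C, D; split=> g; first by case: (AV g).
by rewrite (addnC (B g)).
Qed.

Lemma orientable3CA a b c x : orientable3 a b c x -> orientable3 a c b x.
Proof.
case=> A [B [C [D [AV AB]]]]; exists A, C, B, D; split=> g; first by case: (AV g).
by rewrite (addnAC (A g)).
Qed.

Lemma orientable5_swap12 a b c d x : orientable5 a b c d x -> orientable5 b a c d x.
Proof.
case=> A [B [C [D [E [AV AB]]]]]; exists B, A, C, D, E; split=> g; first by case: (AV g).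
by rewrite (addnC (B g)).
Qed.

Lemma orientable5_rot a b c d x : orientable5 a b c d x -> orientable5 b c d x a.
Proof.
case=> A [B [C [D [E [AV AB]]]]]; exists B, C, D, E, A; split=> g; first by case: (AV g).
by rewrite [_ + A g]addnC !addnA.
Qed.

(** The cubic graph of [a], [x], [x^-1] is directed from one color class to the other, with
    out-degrees 3 and 0; the directed cycles of [y] add 1. *)
Lemma orientable1_bipartite a x y (chi : gT -> bool) :
  (forall g, chi (g * a)%g = ~~ chi g) -> (forall g, chi (g * x)%g = ~~ chi g) ->
  orientable1 a x y.
Proof.
move=> chia chix; exists chi, chi, xpredT; split=> // g.
by rewrite (mulgVK_flip chix) negbK; case: (chi g).
Qed.

Lemma orientable3_bipartite a b c x (chi : gT -> bool) :
  (forall g, chi (g * a)%g = ~~ chi g) -> (forall g, chi (g * b)%g = ~~ chi g) ->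
  (forall g, chi (g * c)%g = ~~ chi g) -> orientable3 a b c x.
Proof.
move=> chia chib chic; exists chi, chi, chi, xpredT; split=> // g.
by case: (chi g).
Qed.

(** The cubic part is that of [a], [x], [x^-1]; the even cycles of [b] and [c], directed by [psi],
    add 1. *)
Lemma orientable3_bipartite1 a b c x (chi : gT -> bool) : involution b -> involution c ->
  (forall g, chi (g * a)%g = ~~ chi g) -> (forall g, chi (g * x)%g = ~~ chi g) ->
  orientable3 a b c x.
Proof.
move=> Ib Ic chia chix; have [psi psiN] := involution_2coloring Ib Ic.
exists chi, psi, (fun g => ~~ psi g), chi; split=> g.
  by have [E1 E2] := psiN g; rewrite E1 E2.
by rewrite (mulgVK_flip chix) negbK; case: (chi g); case: (psi g).
Qed.

Lemma orientable5_bipartite a b c d x (chi : gT -> bool) : involution d -> involution x ->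
  (forall g, chi (g * a)%g = ~~ chi g) -> (forall g, chi (g * b)%g = ~~ chi g) ->
  (forall g, chi (g * c)%g = ~~ chi g) -> orientable5 a b c d x.
Proof.
move=> Id Ix chia chib chic; have [psi psiN] := involution_2coloring Id Ix.
exists chi, chi, chi, psi, (fun g => ~~ psi g); split=> g.
  by have [E1 E2] := psiN g; rewrite E1 E2.
by case: (chi g); case: (psi g).
Qed.

Section Transfer.
Variables (hT : finGroupType) (phi : gT -> hT).
Let covers x (x' : hT) := forall g, phi (g * x)%g = (phi g * x')%g.

Let coversV x (x' : hT) g : covers x x' -> phi (g * x^-1)%g = (phi g * x'^-1)%g.
Proof. by move=> cx; rewrite -[in RHS](mulgKV x g) cx mulgK. Qed.

Lemma orientable1_transfer a x y (a' x' y' : hT) : covers a a' -> covers x x' -> covers y y' ->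
  orientable1 a' x' y' -> orientable1 a x y.
Proof.
move=> ca cx cy [A [B [C [AV AB]]]].
exists (A \o phi), (B \o phi), (C \o phi); split=> g /=; first by rewrite ca AV.
by rewrite (coversV _ cx) (coversV _ cy) AB.
Qed.

Lemma orientable3_transfer a b c x (a' b' c' x' : hT) :
  covers a a' -> covers b b' -> covers c c' -> covers x x' ->
  orientable3 a' b' c' x' -> orientable3 a b c x.
Proof.
move=> ca cb cc cx [A [B [C [D [AV AB]]]]].
exists (A \o phi), (B \o phi), (C \o phi), (D \o phi); split=> g /=.
  by rewrite ca cb cc; apply: AV.
by rewrite (coversV _ cx) AB.
Qed.

End Transfer.
End Criteria.

(** * Complements of an inverted cyclic subgroup *)

Section FrobeniusType.
Variables (gT : finGroupType) (a x y : gT).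
Hypotheses (Ia : involution a) (odd_x : odd #[x]) (xJ : (x ^ a)%g = x^-1%g).
Let F := <[a * y^-1]>%g.
Hypotheses (FxI : F :&: <[x]> = 1%g) (FxT : (F * <[x]>)%g = [set: gT]) (aF : a \notin F).
Let p := #[x].

Let aa : (a * a)%g = 1%g.
Proof. by case/andP: Ia => _ /eqP; rewrite expgS expg1. Qed.

Let xa : (x * a)%g = (a * x^-1)%g.
Proof. by rewrite -xJ conjgE mulKVg. Qed.

Let xVa : (x^-1 * a)%g = (a * x)%g.
Proof. by apply: (mulgI x); rewrite mulKVg mulgA xa mulgKV. Qed.

Let p_gt0 : 0 < p. Proof. exact: order_gt0. Qed.

Let idx_exists g : exists i, (g * x ^- i)%g \in F.
Proof.
have : g \in (F * <[x]>)%g by rewrite FxT inE.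
by case/mulsgP=> f _ fF /cycleP[i ->] ->; exists i; rewrite mulgK.
Qed.
(* g = f x ^ (idx g) with f in F. *)
Let idx g := ex_minn (idx_exists g).

Let idxF g : (g * x ^- (idx g))%g \in F.
Proof. by rewrite /idx; case: ex_minnP. Qed.

Let idx_mod g i : (g * x ^- i)%g \in F -> i = idx g %[mod p].
Proof.
move=> iF; apply/eqP; rewrite -eq_expg_mod_order; apply/eqP.
have : ((g * x ^- i)^-1 * (g * x ^- (idx g)))%g \in F :&: <[x]>.
  rewrite inE groupM ?groupV // ?idxF //=.
  by rewrite invMg invgK -mulgA mulKg groupM ?groupV ?mem_cycle.
rewrite FxI !inE invMg invgK -mulgA mulKg -eq_mulgV1.
by move/eqP.
Qed.

Let idx_lt g : idx g < p.
Proof.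
rewrite {1}/idx; case: ex_minnP => i iF min_i.
apply: leq_ltn_trans (ltn_pmod i p_gt0); apply: min_i.
by rewrite -expg_mod_order in iF.
Qed.

Let idxE g i : i < p -> (g * x ^- i)%g \in F -> idx g = i.
Proof. by move=> ip /idx_mod; rewrite !modn_small. Qed.

Let idx_eq0 g : (idx g == 0) = (g \in F).
Proof.
apply/eqP/idP => [E|gF]; first by have := idxF g; rewrite E expg0 invg1 mulg1.
by apply: idxE; rewrite // expg0 invg1 mulg1.
Qed.

Let idxM g : idx (g * x)%g = (idx g).+1 %% p.
Proof.
apply: idxE; first exact: ltn_pmod.
by rewrite expg_mod_order expgSr invMg mulgA mulgK idxF.
Qed.

(* The index of the element of F a in the coset of g. *)
Let r g := (idx g + idx (g * a)%g) %% p.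

Let rM g : r (g * x)%g = r g.
Proof.
have := idxM (g * a * x^-1)%g; rewrite mulgKV => E.
by rewrite /r -[(g * x * a)%g]mulgA xa mulgA idxM E modnDml modnDmr addSn addnS.
Qed.

Let B g := odd (idx g) == odd (r g).
Let A g := [&& idx g != 0, idx g != r g & B g].

Let idx_eqr g : (idx g == r g) = ((g * a)%g \in F).
Proof.
rewrite -idx_eq0 /r; have := idx_lt g; have := idx_lt (g * a)%g.
move: (idx g) (idx _) => i j jp ip.
have [ij|ij] := ltnP (i + j) p.
  by rewrite modn_small // -{1}[i]addn0 eqn_add2l eq_sym.
have -> : (i + j) %% p = i + j - p.
  by rewrite -{1}(subnK ij) modnDr modn_small //; lia.
lia.
Qed.

(** As [p] is odd, the edges of [x] contribute 1 at index 0 and [2 * B g] elsewhere. Those of [y]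
    contribute 0 on [F], 2 on the coset [F a] and 1 elsewhere. Since [A] vanishes on [F] and [F a]
    and equals [B] elsewhere, the totals are 1, 4 and [1 + 3 * B g]. *)
Let eqA g : (A g + (B g + ~~ B (g * x^-1)%g) + ((g \notin F) + ((g * a)%g \in F))) %% 3 = 1.
Proof.
have Er : r (g * x^-1)%g = r g by rewrite -(rM (g * x^-1)%g) mulgKV.
have Ei : idx g = (idx (g * x^-1)%g).+1 %% p by rewrite -idxM mulgKV.
rewrite /A /B Er -idx_eqr -idx_eq0.
have FFa : (idx g == 0) && (idx g == r g) = false.
  rewrite idx_eq0 idx_eqr; apply/andP => -[gF gaF].
  by case/negP: aF; rewrite -(groupMl _ gF).
have := idx_lt (g * x^-1)%g; move: FFa Ei; move: (idx (g * _)%g) (idx g) (r g) => j i k.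
move=> FFa Ei; rewrite leq_eqVlt => /orP[/eqP jp|jp].
  have Ei0 : i = 0 by rewrite Ei jp modnn.
  have odd_j : odd j = false by move: odd_x; rewrite -/p -jp /= => /negPf.
  by move: FFa; rewrite Ei0 odd_j eqxx /= => ->; case: (odd k).
rewrite modn_small // in Ei; rewrite Ei /=.
by case: eqP => [<-|_] /=; [case: (odd j) | case: (odd j); case: (odd k)].
Qed.

(** [A] need not change sign under [a]. So the rule is kept on one color class of cosets of [<[x]>]
    and carried to the other by [a] with reversal; the edges of [y] contribute complementary amounts
    at [g] and [g * a] anyway. Out-degree [n] becomes [5 - n], again 1 modulo 3. *)
Lemma orientable1_Frobenius : orientable1 a x y.
Proof.
have [|||th [thx tha]] := @coset_2coloring _ <[x]>%G a.
- apply/negP => /order_dvdG; rewrite -orderE => oa.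
  have : #[a] %| gcdn #[x] 2.
    by rewrite dvdn_gcd oa order_dvdn; case/andP: Ia.
  rewrite (eqP (_ : coprime _ _)) ?coprimen2 // dvdn1 order_eq1.
  by case/andP: Ia => /negPf ->.
- by rewrite inE -cycleJ xJ cycleV.
- by rewrite expgS expg1 aa group1.
have tha' g : th (g * a)%g = ~~ th g by apply: tha; rewrite mulVg group1.
have thx' g : th (g * x^-1)%g = th g by apply: thx; rewrite groupV cycle_id.
exists (fun g => if th g then A g else ~~ A (g * a)%g),
  (fun g => if th g then B g else B (g * a * x^-1)%g), (fun g => g \notin F).
have FyE g : ((g * y^-1)%g \in F) = ((g * a)%g \in F).
  have wF : (a * y^-1)%g \in F by exact: cycle_id.
  by rewrite -(groupMr (g * a)%g wF) mulgA -(mulgA g) aa mulg1.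
split=> g; first by rewrite tha' -mulgA aa mulg1; case: (th g); rewrite ?negbK.
rewrite thx' negbK FyE; case: (th g); first exact: eqA.
have := eqA (g * a)%g; rewrite -(mulgA g a a) aa mulg1.
rewrite -(mulgA g x^-1%g a) xVa mulgA mulgK.
by case: (A _); case: (B _); case: (B _); case: (g \in F); case: (_ \in F).
Qed.

End FrobeniusType.

(** * Reduction to smaller groups *)

Section Reduction.
Variable gT : finGroupType.
Implicit Types (a b c d x y g : gT).

(* The elements in M can be moved to a smaller group, along a map phi that
   intertwines right multiplication by x with right multiplication by f x. *)
Definition reducible (M : pred gT) := exists (hT : finGroupType) (phi f : gT -> hT),
  [/\ #|hT| < #|gT|, squarefree #|[set: hT]^`(1)|
    & forall x, M x -> [/\ forall g, phi (g * x)%g = (phi g * f x)%g,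
        x != 1%g -> f x != 1%g & involution x -> involution (f x)]].

(** [phi] gives the position of [g] relative to the representative of its left coset of [H]. *)
Lemma subgroup_reducible (H : {group gT}) : squarefree #|[set: gT]^`(1)| ->
  H != [set: gT] :> {set gT} -> reducible (mem H).
Proof.
move=> sf ltH; pose r g := repr (g *: H)%g.
exists (subg_of H), (fun g => subg H ((r g)^-1 * g)), (subg H); split.
- rewrite -cardsT -[#|gT|]cardsT -(card_injm (@injm_sgval _ H)) // im_sgval.
  by rewrite proper_card // properT.
- apply: squarefree_dvd sf; rewrite -(card_injm (@injm_sgval _ H)) ?der_sub //.
  by rewrite morphim_der // im_sgval cardSg // dergS // subsetT.
move=> x; rewrite -[mem H x]/(x \in H) => xH; have f1 : x != 1%g -> subg H x != 1%g.
  by apply: contraNneq => E; rewrite -[x](subgK _ xH) E.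
split=> // [g|/andP[x1 /eqP x2]].
  have rE : r (g * x)%g = r g by rewrite /r lcosetM (lcoset_id xH).
  have rH : ((r g)^-1 * g)%g \in H.
    rewrite -groupV invMg invgK -mem_lcoset; exact: mem_repr (lcoset_refl _ _).
  by rewrite rE mulgA subgM.
rewrite /involution f1 // expgS expg1 -subgM // -(expgS x 1) x2 /=.
by apply/eqP/val_inj; rewrite /= subgK.
Qed.

Lemma quotient_reducible (N : {group gT}) : squarefree #|[set: gT]^`(1)| ->
  N <| [set: gT] -> N != 1%g :> {set gT} -> reducible (predC (mem N)).
Proof.
move=> sf nN N1; have nNT := normal_norm nN.
have TE : [set: coset_of N] = [set: gT] / N.
  by apply/eqP; rewrite eqEsubset subsetT andbT -(im_coset N) morphimS // subsetT.
have inN g : g \in 'N(N) by apply: subsetP nNT _ (in_setT g).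
exists (coset_of N), (coset N), (coset N); split.
- by rewrite -cardsT -[#|gT|]cardsT TE ltn_quotient ?subsetT.
- rewrite TE -quotient_der //; apply: squarefree_dvd sf; exact: dvdn_quotient.
move=> x /= xN; have f1 : coset N x != 1%g.
  by apply: contra xN => /eqP; apply: coset_idr.
split=> // [g|/andP[x1 /eqP x2]]; first by rewrite morphM.
by rewrite /involution f1 -morphX // x2 morph1 eqxx.
Qed.

Section Structure.
Hypotheses (sfC : squarefree #|[set: gT]^`(1)|).
Let C : {group gT} := [set: gT]^`(1)%G.

Let cycC : cyclic C. Proof. exact: cyclic_der1. Qed.

Lemma subgroup_der1_normal (H : {group gT}) : H \subset C -> H <| [set: gT].
Proof.
move=> sHC; apply: char_normal_trans (der_normal 1 [set: gT]).
by case/cyclicP: cycC sHC => c Ec; rewrite /= -[_^`(1)]/(gval C) Ec; apply: cycle_subgroup_char.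
Qed.

Lemma order_involution a : involution a -> #[a] = 2.
Proof. by case/andP=> a1 /eqP a2; apply: nt_prime_order. Qed.

Lemma involution_der1_eq a b : involution a -> involution b -> a \in C -> b \in C -> a = b.
Proof.
move=> Ia Ib aC bC; have := eq_subG_cyclic cycC (_ : <[a]> \subset C) (_ : <[b]> \subset C).
rewrite !cycle_subG -!orderE !order_involution // eqxx => /(_ aC bC)/eqP E.
have : a \in <[b]> by rewrite -E cycle_id.
rewrite cycle2g ?order_involution // !inE => /orP[|/eqP//].
by case/andP: Ia => /negPf ->.
Qed.

Lemma involution_der1_commute a g : involution a -> a \in C -> commute g a.
Proof.
move=> Ia aC; have : <[a]> <| [set: gT] by apply: subgroup_der1_normal; rewrite cycle_subG.
case/andP=> _ /subsetP/(_ g (in_setT g)); rewrite -groupV => nag.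
have : (a ^ g^-1)%g \in <[a]> by rewrite memJ_norm ?cycle_id.
rewrite cycle2g ?order_involution // !inE conjg_eq1 => /orP[|/eqP E].
  by case/andP: Ia => /negPf ->.
by apply/commute_sym/commgP/conjg_fixP; rewrite -{1}E conjgKV.
Qed.

(** Conjugation by [a] raises [x] to a power [k] with [k ^ 2 = 1] modulo the prime [#[x]], so [k] is
    1 or -1. *)
Lemma conjg_involution_prime a x : involution a -> prime #[x] -> a \in 'N(<[x]>) ->
  (x ^ a)%g \in [:: x; x^-1%g].
Proof.
move=> Ia x_pr nxa; have /cycleP[k xk] : (x ^ a)%g \in <[x]> by rewrite memJ_norm ?cycle_id.
have aa : (a * a)%g = 1%g by case/andP: Ia => _ /eqP; rewrite expgS expg1.
have : (x ^+ (k * k))%g = x.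
  by rewrite expgM -xk -conjXg -xk -conjgM aa conjg1.
move/eqP; rewrite -[X in _ == X]expg1 eq_expg_mod_order => kk.
have k_gt0 : 0 < k.
  case: k kk {xk} => //; rewrite mul0n mod0n modn_small ?prime_gt1 //.
have : #[x] %| (k - 1) * (k + 1).
  rewrite mulnBl mulnDr !muln1 mul1n [k + 1]addnC subnDr -eqn_mod_dvd ?muln_gt0 ?k_gt0 //.
rewrite Euclid_dvdM // xk !inE => /orP[] dv.
  by rewrite -{2}[x]expg1 eq_expg_mod_order eqn_mod_dvd // dv.
by rewrite [X in _ || X]eq_sym eq_invg_mul -expgS -order_dvdn -addn1 dv orbT.
Qed.

End Structure.
End Reduction.

(** * Case analysis *)

Section ValencyFive.
Variable gT : finGroupType.
Hypothesis sfC : squarefree #|[set: gT]^`(1)|.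
Implicit Types (a b c d x y g : gT) (N P : {group gT}).
Let C : {group gT} := [set: gT]^`(1)%G.

Lemma der1_prime_subgroup q : prime q -> q %| #|C| ->
  exists P, [/\ P <| [set: gT], #|P| = q & P \subset C].
Proof.
move=> q_pr /(Cauchy q_pr)[z zC oz]; exists <[z]>%G.
have sz : <[z]> \subset C by rewrite cycle_subG.
by split; rewrite // ?subgroup_der1_normal //.
Qed.

Lemma cycle_prime_subgroup P x : prime #|P| -> x \in P -> x != 1%g -> <[x]> = P.
Proof.
move=> P_pr xP x1; apply/eqP; rewrite eqEsubset cycle_subG xP /=.
by apply: prime_meetG => //; apply/trivgPn; exists x; rewrite // inE xP cycle_id.
Qed.

(** By square-freeness the index of [<[x]>] in [C] is coprime to [#[x]]. *)
Lemma der1_other_prime x : x \in C -> prime #[x] -> <[x]> != C ->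
  exists q, [/\ prime q, q %| #|C| & q != #[x]].
Proof.
move=> xC x_pr neq; have /dvdnP[m Em] := order_dvdG xC.
have m_gt1 : 1 < m.
  rewrite ltn_neqAle; have := cardG_gt0 C; rewrite Em muln_gt0 => /andP[-> _].
  rewrite andbT; apply: contraNneq neq => m1.
  by rewrite eqEcard cycle_subG xC /= Em -m1 mul1n leqnn.
exists (pdiv m); rewrite pdiv_prime // Em dvdn_mulr ?pdiv_dvd //; split=> //.
have : coprime #[x] m by apply: squarefree_prime_coprime => //; rewrite mulnC -Em.
by apply: contraTneq => <-; rewrite prime_coprime ?pdiv_prime // pdiv_dvd.
Qed.

(** The commutator [u] of [y] and [a] is a power of [x], hence commutes with [a]. Conjugating [y]
    twice by [a] gives [u ^ 2 = 1], and the order of [u] is odd. *)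
Lemma commute_involution_odd a x y : involution a -> odd #[x] -> C = <[x]> :> {set gT} ->
  commute x a -> commute y a.
Proof.
move=> Ia ox CE cxa; have aa : (a * a)%g = 1%g.
  by case/andP: Ia => _ /eqP; rewrite expgS expg1.
have uC : [~ y, a] \in <[x]> by rewrite -CE mem_commg ?inE.
set u := [~ y, a] in uC.
have cua : commute u a by have /cycleP[k ->] := uC; apply/commute_sym/commuteX/commute_sym.
have yJ : (y ^ a)%g = (y * u)%g by rewrite /u /commg mulKVg.
have : (y * (u * u))%g = (y * 1)%g.
  rewrite mulgA -yJ -{1}[u](_ : (u ^ a)%g = u) -?conjMg -?yJ -?conjgM ?aa ?conjg1 ?mulg1 //.
  by rewrite conjgE cua mulKg.
move/mulgI => uu.
have /eqP : #[u] == 1.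
  rewrite -dvdn1 -(eqP (_ : coprime #[x] 2)) ?coprimen2 //.
  by rewrite dvdn_gcd order_dvdG // order_dvdn expgS expg1 uu eqxx.
move/eqP; rewrite order_eq1 => /eqP u1.
by apply/commgP; rewrite -/u u1.
Qed.

(** * One involution and two inverse pairs *)

Section One.
Variables a x y : gT.
Hypotheses (Ia : involution a) (x1 : x != 1%g) (y1 : y != 1%g).
Hypotheses (nIx : ~~ involution x) (nIy : ~~ involution y).
Hypothesis genG : <<[set a; x; y]>> = [set: gT].

Let xa : x != a. Proof. by apply: contraNneq nIx => ->. Qed.
Let ya : y != a. Proof. by apply: contraNneq nIy => ->. Qed.

Let conjg_commute z : commute z a -> (z ^ a)%g \in [:: z; z^-1%g].
Proof. by move=> cza; rewrite conjgE cza mulKg !inE eqxx. Qed.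

(** [K] contains [C], so it is normal. If it misses [a], then [a] and [y] both swap its cosets and
    the bipartite criterion applies. Otherwise [K] is the whole group, and either [a] commutes with
    [y] or [<[w]>] is a complement of [<[x]>] without [a]. *)
Lemma orientable1_der1_cycle : prime #[x] -> C = <[x]> :> {set gT} -> orientable1 a x y.
Proof.
move=> x_pr CE; set w := (a * y^-1)%g.
have ox : odd #[x].
  have [x2|] := even_prime x_pr; last by [].
  by case/negP: nIx; rewrite /involution x1 -order_dvdn x2.
have nx : <[x]> <| [set: gT] by rewrite -CE der_normal.
have xJ : (x ^ a)%g \in [:: x; x^-1%g].
  by apply: conjg_involution_prime => //; apply: subsetP (normal_norm nx) _ (in_setT a).
have useZ : commute y a -> orientable1 a x y.
  by move=> cya; apply: orientable1_normalizing => //; apply: conjg_commute.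
pose K := (<[w]> <*> <[x]>)%G.
have sCK : C \subset K by rewrite CE joing_subr.
have nK : [set: gT] \subset 'N(K) by apply: (sub_der1_norm sCK); apply: subsetT.
have wK : w \in K by rewrite /= mem_gen // inE cycle_id.
have xK : x \in K by rewrite /= mem_gen // inE cycle_id orbT.
have [aK|naK] := boolP (a \in K); last first.
  have [||chi [_ chiN]] := @coset_2coloring _ K a naK.
  - by apply: subsetP nK _ (in_setT a).
  - by case/andP: Ia => _ /eqP ->; apply: group1.
  apply/orientable1C/(@orientable1_bipartite _ _ _ _ chi) => g; apply: chiN.
    by rewrite mulVg group1.
  have -> : (a^-1 * y)%g = (w^-1 ^ a)%g by rewrite conjgE /w invMg invgK mulgKV.
  by rewrite memJ_norm ?groupV // (subsetP nK _ (in_setT a)).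
have KT : K = [set: gT] :> {set gT}.
  apply/eqP; rewrite eqEsubset subsetT -genG gen_subG; apply/subsetP => g.
  rewrite !inE => /orP[/orP[]|] /eqP -> //.
  by rewrite -(groupMl _ wK) /w mulgKV.
have [xJ1|xJ1] := eqVneq (x ^ a)%g x.
  apply: useZ; apply: (@commute_involution_odd a x y Ia ox CE).
  by apply/commgP/conjg_fixP.
have xJV : (x ^ a)%g = x^-1%g by move: xJ; rewrite !inE (negPf xJ1) => /eqP.
have yw : y \in <[w]> -> a \in <[w]> -> orientable1 a x y.
  by move=> yw aw; apply: useZ; have /centsP := cycle_abelian w; apply.
have yE : y = (w^-1 * a)%g by rewrite /w invMg invgK mulgKV.
have [wx|nwx] := boolP (<[x]> \subset <[w]>).
  have wT g : g \in <[w]> by have := in_setT g; rewrite -KT /= (joing_idPl wx).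
  exact: yw.
have [aw|naw] := boolP (a \in <[w]>).
  by apply: yw => //; rewrite yE groupM ?groupV ?cycle_id.
apply: orientable1_Frobenius => //; first by rewrite setIC prime_TIg // -orderE.
rewrite -[RHS]KT /= norm_joinEl //.
exact: subset_trans (subsetT _) (normal_norm nx).
Qed.

(** If [<[x]>] is not all of [C], a subgroup [P] of another prime order either can be factored out
    or contains [y], and then [a] maps each of [x] and [y] to itself or its inverse. *)
Lemma orientable1_normal_cycle : prime #[x] -> x \in C ->
  (forall N, N <| [set: gT] -> N != 1%g :> {set gT} ->
     a \notin N -> x \notin N -> y \notin N -> orientable1 a x y) ->
  orientable1 a x y.
Proof.
move=> x_pr xC red.
have norm z : z \in C -> prime #[z] -> (z ^ a)%g \in [:: z; z^-1%g].
  move=> zC z_pr; apply: conjg_involution_prime => //.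
  have /normal_norm/subsetP : <[z]> <| [set: gT].
    by apply: subgroup_der1_normal; rewrite ?cycle_subG.
  by apply; rewrite inE.
have [aC|naC] := boolP (a \in C).
  apply: orientable1_normalizing => //; first exact: norm.
  by apply: conjg_commute; apply: involution_der1_commute.
have [CE|neC] := eqVneq <[x]> C; first exact: orientable1_der1_cycle.
have [q [q_pr qC qx]] := der1_other_prime xC x_pr neC.
have [P [nP cP sPC]] := der1_prime_subgroup q_pr qC.
have P_pr : prime #|P| by rewrite cP.
have [yP|nyP] := boolP (y \in P).
  have yE := cycle_prime_subgroup P_pr yP y1.
  apply: orientable1_normalizing => //; apply: norm => //; first exact: (subsetP sPC).
  by rewrite orderE yE.
apply: (red P) => //.
- by apply: contraTneq P_pr => ->; rewrite cards1.
- by apply: contra naC; apply: (subsetP sPC).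
apply: contra qx => xP; have xE := cycle_prime_subgroup P_pr xP x1.
by rewrite orderE xE cP.
Qed.

End One.
End ValencyFive.

(** * Five involutions *)

Lemma abelian_3coloring (hT : finGroupType) (u v w : hT) : abelian [set: hT] ->
  involution u -> involution v -> involution w -> (u * v * w)%g != 1%g ->
  exists chi : hT -> bool, forall g, [/\ chi (g * u)%g = ~~ chi g,
    chi (g * v)%g = ~~ chi g & chi (g * w)%g = ~~ chi g].
Proof.
move=> abT Iu Iv Iw uvw.
have com (s t : hT) : commute s t by have /centsP := abT; apply; rewrite inE.
have [u1 /eqP u2] := andP Iu; have [v1 /eqP v2] := andP Iv; have [w1 /eqP w2] := andP Iw.
(* The elements of [K] are 1, [u * v], [u * w] and [v * w]; the last one is [u] only if
   [u * v * w = 1]. *)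
pose K := (<[u * v]> <*> <[u * w]>)%G.
have sq (s t : hT) n : (s ^+ 2)%g = 1%g -> (t ^+ 2)%g = 1%g ->
    ((s * t) ^+ n)%g = if odd n then (s * t)%g else 1%g.
  move=> s2 t2; rewrite -(odd_double_half n) expgD -mul2n expgM.
  rewrite [((s * t) ^+ 2)%g]expgMn // s2 t2 mulg1 expg1n mulg1.
  by rewrite mul2n oddD odd_double addbF oddb; case: (odd n).
have uu : (u * u)%g = 1%g by rewrite -u2 expgS expg1.
have [|||chi [_ chiN]] := @coset_2coloring _ K u.
- apply/negP; rewrite /= cent_joinEl; last first.
    by apply/centsP => s _ t _; apply: com.
  case/mulsgP=> _ _ /cycleP[i ->] /cycleP[j ->].
  rewrite !sq //; case: (odd i); case: (odd j) => /eqP.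
  + rewrite (com u v) -mulgA (mulgA u u) uu mul1g eq_sym => /eqP E; case/eqP: uvw.
    by rewrite -mulgA E uu.
  + by rewrite mulg1 -{1}[u]mulg1 (inj_eq (mulgI u)) eq_sym (negPf v1).
  + by rewrite mul1g -{1}[u]mulg1 (inj_eq (mulgI u)) eq_sym (negPf w1).
  by rewrite mulg1 (negPf u1).
- exact: subsetP (sub_abelian_norm abT (subsetT K)) _ (in_setT u).
- by rewrite u2 group1.
exists chi => g; have uV := involutionV Iu; split; apply: chiN; rewrite ?mulVg ?group1 ?uV //.
  by rewrite /= mem_gen // inE cycle_id.
by rewrite /= mem_gen // inE cycle_id orbT.
Qed.

Section AllShapes.
Variable gT : finGroupType.
Hypothesis sfC : squarefree #|[set: gT]^`(1)|.
Implicit Types (a b c d x y z g : gT) (N P : {group gT}).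
Let C : {group gT} := [set: gT]^`(1)%G.

Let der1_3coloring b c d : involution b -> involution c -> involution d ->
  b \notin C -> c \notin C -> d \notin C -> (b * c * d)%g \notin C ->
  exists chi : gT -> bool, forall g, [/\ chi (g * b)%g = ~~ chi g,
    chi (g * c)%g = ~~ chi g & chi (g * d)%g = ~~ chi g].
Proof.
move=> Ib Ic Id bC cC dC bcdC.
have inN g : g \in 'N(C) by apply: subsetP (der_norm 1 [set: gT]) _ (in_setT g).
have cosetM g h : coset C (g * h)%g = (coset C g * coset C h)%g by rewrite morphM.
have Icoset z : involution z -> z \notin C -> involution (coset C z).
  case/andP=> _ /eqP z2 zC; rewrite /involution -morphX // z2 morph1 eqxx andbT.
  by apply: contra zC => /eqP; apply: coset_idr.
have abQ : abelian [set: coset_of C].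
  by rewrite -(im_coset C) (abelianS (morphimS _ (subsetT _))) // der_abelian.
have [|chi chiN] := abelian_3coloring abQ (Icoset _ Ib bC) (Icoset _ Ic cC) (Icoset _ Id dC).
  by apply: contra bcdC => /eqP; rewrite -!cosetM; apply: coset_idr.
by exists (chi \o coset C) => g /=; rewrite !cosetM; apply: chiN.
Qed.

Let orientable5_3coloring b c d x z : involution x -> involution z ->
  (exists chi : gT -> bool, forall g, [/\ chi (g * b)%g = ~~ chi g,
    chi (g * c)%g = ~~ chi g & chi (g * d)%g = ~~ chi g]) -> orientable5 b c d x z.
Proof.
move=> Ix Iz [chi chiN]; apply: (orientable5_bipartite (chi := chi)) => // g;
by case: (chiN g).
Qed.

Let swap23 a b c d x : orientable5 a b c d x -> orientable5 a c b d x.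
Proof.
by move=> /orientable5_rot/orientable5_swap12/orientable5_rot/orientable5_rot/orientable5_rot/orientable5_rot.
Qed.

Let swap34 a b c d x : orientable5 a b c d x -> orientable5 a b d c x.
Proof. by move=> /orientable5_rot/swap23; do 4 move/orientable5_rot. Qed.

(** If [b * c * d] and [b * c * x] are both in [C], then so is [d * x], and therefore [b * d * x] is
    not. *)
Let orientable5_notin_der1 b c d x z : involution b -> involution c -> involution d ->
  involution x -> involution z ->
  b \notin C -> c \notin C -> d \notin C -> x \notin C -> orientable5 b c d x z.
Proof.
move=> Ib Ic Id Ix Iz bC cC dC xC.
have [bcd|] := boolP ((b * c * d)%g \in C); last first.
  by move=> bcd; apply: orientable5_3coloring => //; apply: der1_3coloring.
have [bcx|] := boolP ((b * c * x)%g \in C); last first.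
  by move=> bcx; apply/swap34/orientable5_3coloring => //; apply: der1_3coloring.
apply/swap23/swap34/orientable5_3coloring => //; apply: der1_3coloring => //.
apply: contra bC; have dx : (d * x)%g \in C.
  have := groupM (groupVr bcd) bcx; rewrite invMg -mulgA mulKg.
  by rewrite (involutionV Id).
by rewrite -mulgA groupMr.
Qed.

Let orientable5_eq a c d x : involution a -> involution c -> involution d -> involution x ->
  orientable5 a a c d x.
Proof.
move=> Ia Ic Id Ix; have [chi chiN] := involution_2coloring Ia Ic.
by apply: (orientable5_bipartite (chi := chi)) => // g; case: (chiN g).
Qed.

(** [a] is the only involution of [C]: another label in [C] repeats [a], and otherwise the other
    four labels lie outside [C]. *)
Let orientable5_in_der1 a b c d x : involution a -> involution b -> involution c ->
  involution d -> involution x -> a \in C -> orientable5 a b c d x.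
Proof.
move=> Ia Ib Ic Id Ix aC; have eqa z : involution z -> z \in C -> a = z.
  by move=> Iz zC; apply: involution_der1_eq.
have [bC|nbC] := boolP (b \in C); first by rewrite -(eqa b) //; apply: orientable5_eq.
have [cC|ncC] := boolP (c \in C).
  by rewrite -(eqa c) //; apply/swap23/orientable5_eq.
have [dC|ndC] := boolP (d \in C).
  by rewrite -(eqa d) //; apply/swap34/swap23/orientable5_eq.
have [xC|nxC] := boolP (x \in C).
  rewrite -(eqa x) //; apply/orientable5_rot/orientable5_eq => //.
by do 4 apply: orientable5_rot; apply: orientable5_notin_der1.
Qed.

Lemma squarefree_orientable5 a b c d x : involution a -> involution b -> involution c ->
  involution d -> involution x -> orientable5 a b c d x.
Proof.
move=> Ia Ib Ic Id Ix.
have [aC|naC] := boolP (a \in C); first exact: orientable5_in_der1.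
have [bC|nbC] := boolP (b \in C); first by apply/orientable5_swap12/orientable5_in_der1.
have [cC|ncC] := boolP (c \in C).
  by apply/swap23/orientable5_swap12/orientable5_in_der1.
have [dC|ndC] := boolP (d \in C).
  by apply/swap34/swap23/orientable5_swap12/orientable5_in_der1.
exact: orientable5_notin_der1.
Qed.

End AllShapes.

(** * Induction on the order of the group, and conclusion *)

Lemma trivg_der1_commute (gT : finGroupType) (g h : gT) :
  #|[set: gT]^`(1)| <= 1 -> commute g h.
Proof.
move=> /card_le1_trivg C1; have /centsP : abelian [set: gT] by apply/derG1P.
by apply; rewrite inE.
Qed.

Lemma squarefree_orientable1 (gT : finGroupType) (a x y : gT) :
  squarefree #|[set: gT]^`(1)| -> involution a -> x != 1%g -> y != 1%g ->
  orientable1 a x y.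
Proof.
have [k] := ubnP #|gT|; elim: k => // k IHk in gT a x y *.
move=> le_k sfC Ia x1 y1.
have red (M : pred gT) : reducible M -> M a -> M x -> M y -> orientable1 a x y.
  case=> hT [phi [f [lt sf Mf]]] /Mf[ca _ If] /Mf[cx fx _] /Mf[cy fy _].
  apply: (orientable1_transfer ca cx cy); apply: IHk; rewrite ?fx ?fy ?If //.
  by rewrite -ltnS; apply: leq_trans le_k.
have [Ix|nIx] := boolP (involution x).
  have [chi chiN] := involution_2coloring Ia Ix.
  by apply: (@orientable1_bipartite _ _ _ _ chi) => g; case: (chiN g).
have [Iy|nIy] := boolP (involution y).
  have [chi chiN] := involution_2coloring Ia Iy.
  by apply: orientable1C; apply: (@orientable1_bipartite _ _ _ _ chi) => g; case: (chiN g).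
have [genG|ngen] := eqVneq <<[set a; x; y]>> [set: gT]; last first.
  by apply: (red _ (subgroup_reducible sfC ngen)); rewrite /= mem_gen // !inE eqxx ?orbT.
have xa : x != a by apply: contraNneq nIx => ->.
have ya : y != a by apply: contraNneq nIy => ->.
have central : (forall g, commute g a) -> orientable1 a x y.
  by move=> cga; apply: orientable1_normalizing => //; rewrite conjgE cga mulKg !inE eqxx.
have [aC|naC] := boolP (a \in [set: gT]^`(1)).
  by apply: central => g; apply: involution_der1_commute.
have [C1|C_gt1] := leqP #|[set: gT]^`(1)| 1.
  by apply: central => g; apply: trivg_der1_commute.
have q_pr := pdiv_prime C_gt1.
have redN (N : {group gT}) : N <| [set: gT] -> N != 1%g :> {set gT} ->
    a \notin N -> x \notin N -> y \notin N -> orientable1 a x y.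
  by move=> nN N1; apply: (red _ (quotient_reducible sfC nN N1)).
have [P [nP cP sPC]] := der1_prime_subgroup sfC q_pr (pdiv_dvd _).
have P_pr : prime #|P| by rewrite cP.
have prime_cyc z : z \in P -> z != 1%g -> prime #[z].
  by move=> zP z1; rewrite orderE (cycle_prime_subgroup P_pr zP z1).
(* As [a] is not in [C], the quotient by [P] is available unless [P] contains [x] or [y]. *)
have [xP|nxP] := boolP (x \in P).
  by apply: orientable1_normal_cycle => //; [apply: prime_cyc | apply: (subsetP sPC)].
have [yP|nyP] := boolP (y \in P).
  apply/orientable1C/orientable1_normal_cycle => //.
  - by rewrite setUAC.
  - exact: prime_cyc.
  - exact: (subsetP sPC).
  by move=> N nN N1 aN yN xN; apply/orientable1C/(redN N).
apply: (redN P) => //; first by apply: contraTneq P_pr => ->; rewrite cards1.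
by apply: contra naC; apply: (subsetP sPC).
Qed.

Lemma squarefree_orientable3 (gT : finGroupType) (a b c x : gT) :
  squarefree #|[set: gT]^`(1)| -> involution a -> involution b -> involution c ->
  x != 1%g -> orientable3 a b c x.
Proof.
have [k] := ubnP #|gT|; elim: k => // k IHk in gT a b c x *.
move=> le_k sfC Ia Ib Ic x1.
have red (M : pred gT) : reducible M -> M a -> M b -> M c -> M x -> orientable3 a b c x.
  case=> hT [phi [f [lt sf Mf]]] /Mf[ca _ fa] /Mf[cb _ fb] /Mf[cc _ fc] /Mf[cx fx _].
  apply: (orientable3_transfer ca cb cc cx); apply: IHk; rewrite ?fa ?fb ?fc ?fx //.
  by rewrite -ltnS; apply: leq_trans le_k.
have [Ix|nIx] := boolP (involution x).
  have [chi chiN] := involution_2coloring Ia Ix.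
  by apply: (@orientable3_bipartite1 _ _ _ _ _ chi) => // g; case: (chiN g).
have [genG|ngen] := eqVneq <<[set a; b; c; x]>> [set: gT]; last first.
  by apply: (red _ (subgroup_reducible sfC ngen)); rewrite /= mem_gen // !inE eqxx ?orbT.
have nx z : involution z -> x != z by move=> Iz; apply: contraNneq nIx => ->.
have [ab|nab] := eqVneq b a.
  have [chi chiN] := involution_2coloring Ia Ic.
  by rewrite ab; apply: (@orientable3_bipartite _ _ _ _ _ chi) => g; case: (chiN g).
have [ac|nac] := eqVneq c a.
  have [chi chiN] := involution_2coloring Ia Ib.
  by rewrite ac; apply: (@orientable3_bipartite _ _ _ _ _ chi) => g; case: (chiN g).
have [bc|nbc] := eqVneq c b.
  have [chi chiN] := involution_2coloring Ia Ib.
  by rewrite bc; apply: (@orientable3_bipartite _ _ _ _ _ chi) => g; case: (chiN g).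
have centrala : commute b a -> commute c a -> commute x a -> orientable3 a b c x.
  by move=> *; apply: orientable3_central => //; apply: nx.
have centralb : commute a b -> commute c b -> commute x b -> orientable3 a b c x.
  move=> *; apply/orientable3C/orientable3_central => //; [by rewrite eq_sym | exact: nx |].
  by rewrite -genG; congr <<_>>; rewrite (setUC [set b]).
have centralc : commute a c -> commute b c -> commute x c -> orientable3 a b c x.
  move=> *; apply/orientable3CA/orientable3C/orientable3_central => //;
    [by rewrite eq_sym | by rewrite eq_sym | exact: nx |].
  by rewrite -genG; congr <<_>>; rewrite (setUC [set c]) (setUAC [set a]).
have [aC|naC] := boolP (a \in [set: gT]^`(1)).
  by apply: centrala; apply: involution_der1_commute.
have [bC|nbC] := boolP (b \in [set: gT]^`(1)).
  by apply: centralb; apply: involution_der1_commute.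
have [cC|ncC] := boolP (c \in [set: gT]^`(1)).
  by apply: centralc; apply: involution_der1_commute.
have [C1|C_gt1] := leqP #|[set: gT]^`(1)| 1.
  by apply: centrala; apply: trivg_der1_commute.
have prime_sub (P : {group gT}) : P <| [set: gT] -> prime #|P| -> P \subset [set: gT]^`(1) ->
    (x \in P -> orientable3 a b c x) -> orientable3 a b c x.
  move=> nP P_pr sPC xP; have [/xP //|nxP] := boolP (x \in P).
  have P1 : P != 1%g :> {set gT} by apply: contraTneq P_pr => ->; rewrite cards1.
  have nin z : z \notin [set: gT]^`(1) -> z \notin P by apply: contra; apply: (subsetP sPC).
  by apply: (red _ (quotient_reducible sfC nP P1)) => //=; apply: nin.
have [P [nP cP sPC]] := der1_prime_subgroup sfC (pdiv_prime C_gt1) (pdiv_dvd _).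
have P_pr : prime #|P| by rewrite cP pdiv_prime.
apply: (prime_sub P) => // xP; have xE := cycle_prime_subgroup P_pr xP x1.
have x_pr : prime #[x] by rewrite orderE xE.
have xC : x \in [set: gT]^`(1) by apply: (subsetP sPC).
have [CE|neC] := eqVneq <[x]> [set: gT]^`(1); last first.
  have [q [q_pr qC qx]] := der1_other_prime sfC xC x_pr neC.
  have [Q [nQ cQ sQC]] := der1_prime_subgroup sfC q_pr qC.
  have Q_pr : prime #|Q| by rewrite cQ.
  apply: (prime_sub Q) => // xQ; case/eqP: qx.
  by rewrite -cQ -(cycle_prime_subgroup Q_pr xQ x1).
have ox : odd #[x].
  have [x2|//] := even_prime x_pr.
  by case/negP: nIx; rewrite /involution x1 -order_dvdn x2.
have comm z y : involution z -> commute x z -> commute y z.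
  by move=> Iz; apply: commute_involution_odd.
have nxT : [set: gT] \subset 'N(<[x]>) by rewrite CE der_norm.
have xJ z : involution z -> ~ commute x z -> (x ^ z)%g = x^-1%g.
  move=> Iz ncz; have := conjg_involution_prime Iz x_pr (subsetP nxT z (in_setT z)).
  rewrite !inE => /orP[/eqP E|/eqP //].
  by case: ncz; apply/commgP/conjg_fixP.
have dec z : commute x z \/ ~ commute x z.
  by have [E|E] := eqVneq (x * z)%g (z * x)%g; [left | right; apply/eqP].
case: (dec a) => [ca|nca]; first by apply: centrala => //; apply: comm.
case: (dec b) => [cb|ncb]; first by apply: centralb => //; apply: comm.
case: (dec c) => [cc|ncc]; first by apply: centralc => //; apply: comm.
(* All three involutions now invert [x], so [K] centralizes [x] and misses [a]. It is normal because
   it contains [C], and [a], [b], [c] lie in one coset of it. *)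
pose K := (<<[set (a * b)%g; (a * c)%g]>> <*> <[x]>)%G.
have sCK : [set: gT]^`(1) \subset K by rewrite -CE joing_subr.
have nK : [set: gT] \subset 'N(K) by apply: (sub_der1_norm sCK); apply: subsetT.
have naK : a \notin K.
  apply/negP => aK; apply: (nca); apply/commute_sym/cent1P.
  apply: subsetP aK; rewrite /= join_subG gen_subG cycle_subG cent1id andbT.
  apply/subsetP => z /set2P[] ->; rewrite cent1C;
    apply/cent1P/commgP/conjg_fixP; rewrite conjgM (xJ a Ia nca) conjVg.
    by rewrite (xJ b Ib ncb) invgK.
  by rewrite (xJ c Ic ncc) invgK.
have [||chi [_ chiN]] := @coset_2coloring _ K a naK.
- exact: subsetP nK _ (in_setT a).
- by case/andP: Ia => _ /eqP ->; apply: group1.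
apply: (@orientable3_bipartite _ _ _ _ _ chi) => g; apply: chiN; rewrite ?mulVg ?group1 //;
  by rewrite involutionV // /= mem_gen // inE mem_gen // !inE eqxx ?orbT.
Qed.

Theorem theorem1p3 (gT : finGroupType) (X : {mset gT}) :
  squarefree #|[set: gT]^`(1)| ->
  connection_multiset X ->
  4 <= size X ->
  admits_nowhere_zero_flow (Cay X) 3.
Proof.
move=> sfC connX; apply: orientable_Cay_flow => // *.
- exact: squarefree_orientable1.
- exact: squarefree_orientable3.
exact: squarefree_orientable5.
Qed.
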